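(* Let $d\geq1$, let $\mathbf k$ be a field with $\operatorname{char}(\mathbf k)=2$, let $\Lambda=\mathbf k[\varepsilon]/(\varepsilon^2)$ and $\boldsymbol\Lambda=\mathbf k[\imath^{\pm1}]\otimes\Lambda$ with $|\imath|=-d$. Let $\eta=u^{d+2}$, where $u\in\operatorname{HH}^1(\Lambda)$ is the class of the derivation with $u(\varepsilon)=1$, and let $\{m_{d+2}^\eta\}=\imath\cdot\eta\in\operatorname{HH}^{d+2,-d}(\boldsymbol\Lambda)$ be the associated class. Let $a,b\in\mathbf k$ with $b\neq0$. Then $$\Delta(\{m_{d+2}^\eta\})=\Delta(\imath\cdot\eta)=\begin{cases}(ab^{-1}+a^2b^{-2}\varepsilon)\,\imath\cdot u^{d+1}&d\text{ is odd},\\0&d\text{ is even},\end{cases}$$ where $\Delta=\Delta_\varphi$ is the Batalin--Vilkovisky operator associated with the isomorphism of graded $\boldsymbol\Lambda$-bimodules $\varphi=\varphi_{a,b}\colon\boldsymbol\Lambda\to D\boldsymbol\Lambda$ whose associated pairing has the non-zero components $\langle\imath^{-k}x,\imath^ky\rangle=\langle x,y\rangle_{a,b}$, $x,y\in\Lambda$, $k\in\mathbb Z$. In particular, $\Delta(\imath\cdot\eta)=0$ if and only if $d$ is even or $d$ is odd and $a=0$.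
   Context: The pairing $\langle-,-\rangle_{a,b}\colon\Lambda\times\Lambda\to\mathbf k$ is the bilinear pairing with $\langle1,1\rangle_{a,b}=a$, $\langle1,\varepsilon\rangle_{a,b}=\langle\varepsilon,1\rangle_{a,b}=b$, $\langle\varepsilon,\varepsilon\rangle_{a,b}=0$. $D$ denotes the graded $\mathbf k$-linear dual. For a graded algebra $B$, $C^{p,q}(B)$ is the space of degree $q$ linear maps $B^{\otimes p}\to B$ and $\operatorname{HH}^{p,q}(B)$ is the cohomology of the Hochschild differential (in characteristic $2$ all signs are irrelevant). The cup product is $(c_1\cdot c_2)(x_1,\dots,x_{p+s})=c_1(x_1,\dots,x_p)c_2(x_{p+1},\dots,x_{p+s})$, and the Gerstenhaber square is induced by $\operatorname{Sq}(c)=\sum_{i}c(\mathrm{id}^{\otimes i-1}\otimes c\otimes\mathrm{id}^{\otimes p-i})$. There are isomorphisms of bigraded algebras $\operatorname{HH}^{\bullet,*}(\boldsymbol\Lambda)\cong\mathbf k[\varepsilon,u,\imath^{\pm1},\delta]/(\varepsilon^2,\delta^2)$ with bidegrees $|\varepsilon|=(0,0)$, $|u|=(1,0)$, $|\imath|=(0,-d)$, $|\delta|=(1,0)$: here $\varepsilon,\imath$ are the corresponding central elements of $\boldsymbol\Lambda$, $u$ is the derivation of $\boldsymbol\Lambda$ with $u(\varepsilon)=1$, $u(\imath)=0$, and $\delta$ is the derivation $x\mapsto\frac{|x|}{d}x$. Restriction along $j\colon\Lambda=\boldsymbol\Lambda^0\hookrightarrow\boldsymbol\Lambda$ is the quotient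 map $j^*$ to $\operatorname{HH}^{\bullet,*}(\Lambda,\boldsymbol\Lambda)\cong\mathbf k[\varepsilon,u,\imath^{\pm1}]/(\varepsilon^2)$ killing $\delta$. The class $\{m^\eta_{d+2}\}\in\operatorname{HH}^{d+2,-d}(\boldsymbol\Lambda)$ is the unique class with $\operatorname{Sq}(\{m_{d+2}^\eta\})=0$ and $j^*\{m_{d+2}^\eta\}=\imath\cdot\eta$. The Batalin--Vilkovisky operator of an isomorphism $\varphi\colon B\to DB$ of graded bimodules with associated pairing $\langle x,y\rangle=\varphi(x)(y)$ is (in characteristic $2$) the operator $\Delta_\varphi\colon C^{p,r}(B)\to C^{p-1,r}(B)$ determined by $$\langle\Delta_\varphi(c)(x_1,\dots,x_{p-1}),x_p\rangle=\sum_{i=1}^p\langle c(x_i,\dots,x_p,x_1,\dots,x_{i-1}),1\rangle ;$$ it commutes with the Hochschild differential on the quasi-isomorphic subcomplex of normalised cochains (those vanishing when some input is $1$), hence induces $\Delta_\varphi\colon\operatorname{HH}^{p,r}(B)\to\operatorname{HH}^{p-1,r}(B)$. *)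

(* Defs.v *)
From HB Require Import structures.
From mathcomp Require Import all_boot all_order all_algebra.
From mathcomp Require Import qpoly ring_quotient generic_quotient finmap ring.
From mathcomp Require Import boolp classical_sets functions.

Set Implicit Arguments.
Unset Strict Implicit.
Unset Printing Implicit Defensive.

Import GRing.Theory.
Local Open Scope ring_scope.
Local Open Scope quotient_scope.

(* Laurent polynomials over R in one variable iota: f n is the coefficient of
   iota ^ n. *)
Definition laurent (R : nzRingType) := {fsfun int -> R with 0}.

Section LaurentRing.
Variable R : nzRingType.
Implicit Types (f g h : laurent R) (S : {fset int}).

HB.instance Definition _ := Choice.on (laurent R).

Definition lmono (n : int) (x : R) : laurent R := [fsfun m in [fset n]%fset => x].

Definition ladd f g : laurent R :=
  [fsfun n in (finsupp f `|` finsupp g)%fset => f n + g n].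
Definition lopp f : laurent R := [fsfun n in finsupp f => - f n].
Definition lmul f g : laurent R :=
  [fsfun n in [fset (i + j)%R | i in finsupp f, j in finsupp g]%fset =>
    \sum_(i <- finsupp f) f i * g (n - i)].

Lemma laurentP f g : f =1 g -> f = g. Proof. by move=> h; apply/fsfunP. Qed.

Lemma lmonoE n x m : lmono n x m = if m == n then x else 0.
Proof. by rewrite fsfun_fun inE. Qed.

Lemma laddE f g n : ladd f g n = f n + g n.
Proof.
rewrite fsfun_fun in_fsetU !mem_finsupp.
by case: eqP => // ->; case: eqP => // ->; rewrite addr0.
Qed.

Lemma loppE f n : lopp f n = - f n.
Proof. by rewrite fsfun_fun mem_finsupp; case: eqP => // ->; rewrite oppr0. Qed.

Lemma lmul_widen f g n S : (finsupp f `<=` S)%fset ->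
  lmul f g n = \sum_(i <- S) f i * g (n - i).
Proof.
move=> sfS; rewrite fsfun_fun.
transitivity (\sum_(i <- finsupp f) f i * g (n - i)).
  case: imfset2P => // nij; symmetry; rewrite big_seq big1 // => i fi.
  have [gi|] := boolP (n - i \in finsupp g).
    by case: nij; exists i => //; exists (n - i) => //; rewrite addrC subrK.
  by rewrite memNfinsupp => /eqP ->; rewrite mulr0.
apply: big_fset_incl => // i _; rewrite memNfinsupp => /eqP ->.
by rewrite mul0r.
Qed.

Lemma lmulE f g n : lmul f g n = \sum_(i <- finsupp f) f i * g (n - i).
Proof. exact: lmul_widen. Qed.

Lemma laddA : associative ladd.
Proof. by move=> f g h; apply: laurentP => n; rewrite !laddE addrA. Qed.
Lemma laddC : commutative ladd.
Proof. by move=> f g; apply: laurentP => n; rewrite !laddE addrC. Qed.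
Lemma ladd0 : left_id [fsfun] ladd.
Proof. by move=> f; apply: laurentP => n; rewrite laddE fsfun0E add0r. Qed.
Lemma laddN : left_inverse [fsfun] lopp ladd.
Proof.
by move=> f; apply: laurentP => n; rewrite laddE loppE fsfun0E addNr.
Qed.

HB.instance Definition _ :=
  GRing.isZmodule.Build (laurent R) laddA laddC ladd0 laddN.

Lemma lmulA : associative lmul.
Proof.
move=> f g h; apply: laurentP => n.
pose S := [fset (i + j)%R | i in finsupp f, j in finsupp g]%fset.
have sS : (finsupp (lmul f g) `<=` S)%fset by apply: finsupp_sub.
rewrite lmulE (lmul_widen _ _ sS).
under [RHS]eq_bigr do rewrite lmulE big_distrl /=.
rewrite exchange_big /=; apply: eq_big_seq => i fi.
rewrite lmulE big_distrr /=.
pose T := [fset (i + j)%R | j in finsupp g]%fset.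
have sTS : (T `<=` S)%fset.
  apply/fsubsetP => m /imfsetP[j /= gj ->].
  by apply/imfset2P; exists i => //; exists j.
rewrite -(big_fset_incl _ sTS) /=; last first.
  move=> m _ mT; have [gm|] := boolP (m - i \in finsupp g).
    case/negP: mT; apply/imfsetP; exists (m - i) => //=.
    by rewrite addrC subrK.
  by rewrite memNfinsupp => /eqP ->; rewrite mulr0 mul0r.
rewrite big_imfset /=; last by move=> x y _ _; apply: addrI.
apply: eq_big_seq => j _.
by rewrite mulrA opprD !addrA (addrAC i j) subrr add0r.
Qed.

Lemma lmul1l : left_id (lmono 0 1) lmul.
Proof.
move=> f; apply: laurentP => n.
rewrite (@lmul_widen _ _ _ [fset 0]%fset); last exact: finsupp_sub.
by rewrite big_seq_fset1 lmonoE eqxx mul1r subr0.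
Qed.

Lemma lmul1r : right_id (lmono 0 1) lmul.
Proof.
move=> f; apply: laurentP => n; rewrite lmulE.
have [fn|] := boolP (n \in finsupp f).
  rewrite (big_fsetD1 n) //= lmonoE subrr eqxx mulr1 big_seq big1 ?addr0 //.
  move=> i; rewrite in_fsetD1 => /andP[ni _].
  by rewrite lmonoE subr_eq0 eq_sym (negPf ni) mulr0.
move=> nf; have := nf; rewrite memNfinsupp => /eqP ->.
rewrite big_seq big1 // => i fi; rewrite lmonoE subr_eq0.
by case: eqP => [ni|_]; [rewrite ni fi in nf | rewrite mulr0].
Qed.

Lemma lmulDl : left_distributive lmul +%R.
Proof.
move=> f g h; apply: laurentP => n.
rewrite laddE; set S := (finsupp f `|` finsupp g)%fset.
rewrite (@lmul_widen (f + g) _ _ S); last exact: finsupp_sub.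
rewrite (@lmul_widen f _ _ S) ?fsubsetUl // (@lmul_widen g _ _ S) ?fsubsetUr //.
by rewrite -big_split; apply: eq_bigr => i _; rewrite laddE mulrDl.
Qed.

Lemma lmulDr : right_distributive lmul +%R.
Proof.
move=> f g h; apply: laurentP => n.
rewrite laddE !lmulE -big_split.
by apply: eq_bigr => i _; rewrite laddE mulrDr.
Qed.

Lemma lone_neq0 : lmono 0 1 != 0 :> laurent R.
Proof.
apply/eqP => /(congr1 (fun f : laurent R => f 0)).
by rewrite lmonoE eqxx fsfun0E => /eqP; rewrite oner_eq0.
Qed.

HB.instance Definition _ := GRing.Zmodule_isNzRing.Build (laurent R)
  lmulA lmul1l lmul1r lmulDl lmulDr lone_neq0.

End LaurentRing.

Section LaurentComRing.
Variable R : comNzRingType.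
Implicit Types f g : laurent R.

Lemma lmulC f g : lmul f g = lmul g f.
Proof.
apply: laurentP => n.
pose S := (finsupp f `|` [fset (n - m)%R | m in finsupp g])%fset.
pose T := [fset (n - m)%R | m in S]%fset.
have fS : (finsupp f `<=` S)%fset by apply: fsubsetUl.
have gT : (finsupp g `<=` T)%fset.
  apply/fsubsetP => m gm; apply/imfsetP; exists (n - m) => /=.
    by apply/fsetUP; right; apply/imfsetP; exists m.
  by rewrite subKr.
rewrite (lmul_widen _ _ fS) (lmul_widen _ _ gT) [RHS]big_imfset /=.
  by apply: eq_bigr => i _; rewrite subKr mulrC.
by move=> x y _ _ /addrI /oppr_inj.
Qed.

HB.instance Definition _ :=
  GRing.PzSemiRing_hasCommutativeMul.Build (laurent R) lmulC.

End LaurentComRing.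

Section LaurentAlgebra.
Variables (k : nzRingType) (R : algType k).
Implicit Types f g : laurent R.

Definition lscale (c : k) f : laurent R := [fsfun n in finsupp f => c *: f n].

Lemma lscaleE c f n : lscale c f n = c *: f n.
Proof. by rewrite fsfun_fun mem_finsupp; case: eqP => // ->; rewrite scaler0. Qed.

Lemma lscaleA c c' f : lscale c (lscale c' f) = lscale (c * c') f.
Proof. by apply: laurentP => n; rewrite !lscaleE scalerA. Qed.
Lemma lscale1 : left_id 1 lscale.
Proof. by move=> f; apply: laurentP => n; rewrite lscaleE scale1r. Qed.
Lemma lscaleDr : right_distributive lscale +%R.
Proof.
by move=> c f g; apply: laurentP => n; rewrite !(lscaleE, laddE) scalerDr.
Qed.
Lemma lscaleDl f : {morph lscale^~ f : c c' / c + c'}.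
Proof.
by move=> c c'; apply: laurentP => n; rewrite !(lscaleE, laddE) scalerDl.
Qed.

HB.instance Definition _ := GRing.Zmodule_isLmodule.Build k (laurent R)
  lscaleA lscale1 lscaleDr lscaleDl.

Lemma lscaleAl c f g : c *: (f * g) = (c *: f) * g.
Proof.
apply: laurentP => n; rewrite lscaleE lmulE (@lmul_widen _ _ _ _ (finsupp f)).
  by rewrite scaler_sumr; apply: eq_bigr => i _; rewrite lscaleE scalerAl.
exact: finsupp_sub.
Qed.
Lemma lscaleAr c f g : c *: (f * g) = f * (c *: g).
Proof.
apply: laurentP => n; rewrite lscaleE !lmulE scaler_sumr.
by apply: eq_bigr => i _; rewrite lscaleE scalerAr.
Qed.

HB.instance Definition _ :=
  GRing.Lmodule_isLalgebra.Build k (laurent R) lscaleAl.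
HB.instance Definition _ :=
  GRing.Lalgebra_isAlgebra.Build k (laurent R) lscaleAr.

End LaurentAlgebra.

(* The homogeneous components of a graded vector space, by degree. *)
Record grading (k : nzRingType) (V : lmodType k) := Grading {
  piece :> int -> set V;
  grading_submod : forall n, piece n 0 /\
    forall (c : k) x y, piece n x -> piece n y -> piece n (c *: x + y)
}.

(* Hochschild cochains of an algebra A with coefficients in an algebra B, viewed
   as an A-bimodule through j : A -> B; for j the identity these are the
   Hochschild cochains of A.  The base field is meant to have characteristic 2:
   all the signs of the general theory are dropped. *)
Section Hochschild.
Variables (k : fieldType) (A B : algType k) (j : A -> B).
Variables (gA : grading A) (gB : grading B).

Local Notation cochain p := (('I_p -> A) -> B).

Definition multilinear p (c : cochain p) := forall (i : 'I_p) x (r : k) y z,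
  c [eta x with i |-> r *: y + z] =
    r *: c [eta x with i |-> y] + c [eta x with i |-> z].

Definition homogeneous p (q : int) (c : cochain p) :=
  forall (n : 'I_p -> int) x, (forall i, gA (n i) (x i)) ->
    gB (\sum_i n i + q) (c x).

Definition cochains p (q : int) : set (cochain p) :=
  [set c | multilinear c /\ homogeneous q c].

(* [inner_face i x] multiplies the entries i and i + 1 of x. *)
Definition inner_face p (x : 'I_p.+1 -> A) (i : 'I_p) : 'I_p -> A := fun l =>
  if l == i then x (lift ord_max i) * x (lift ord0 i)
  else x (lift (lift ord_max i) l).

Definition hdiff p (c : cochain p) : cochain p.+1 := fun x =>
  j (x ord0) * c (x \o lift ord0) + \sum_(i < p) c (inner_face x i)
  + c (x \o lift ord_max) * j (x ord_max).

Lemma hdiffB p (c c' : cochain p) : hdiff (c - c') = hdiff c - hdiff c'.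
Proof.
apply/funext => x; rewrite /hdiff -[LHS]/(_ + _ + _).
have E y : (c - c') y = c y - c' y by [].
under eq_bigr do rewrite E.
rewrite !E sumrB mulrBr mulrBl -[RHS]/(_ - _) /hdiff opprD [RHS]addrACA.
by congr (_ + _); rewrite opprD [RHS]addrACA.
Qed.

Definition is_cocycle p q : {pred cochain p} :=
  fun c => `[< cochains q c /\ hdiff c = 0 >].
Arguments is_cocycle p q _ /.

Lemma is_cocycle_zmod_closed p q : zmod_closed (@is_cocycle p q).
Proof.
split=> [|c c'].
  apply/asboolP; split; first split.
  - by move=> i x r y z; rewrite scaler0 addr0.
  - by move=> n x _; case: (grading_submod gB (\sum_i n i + q)).
  - apply/funext => x; rewrite /hdiff mulr0 mul0r add0r addr0.
    by rewrite big1.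
move=> /asboolP[[lc hc] dc] /asboolP[[lc' hc'] dc']; apply/asboolP.
split; first split.
- move=> i x r y z; rewrite -[LHS]/(c _ - c' _) lc lc'.
  rewrite -[in RHS]/(r *: (c _ - c' _) + (c _ - c' _)).
  by rewrite scalerBr opprD addrACA.
- move=> n x xn; have [_ /(_ (-1))] := grading_submod gB (\sum_i n i + q).
  move=> /(_ _ _ (hc' n x xn) (hc n x xn)).
  by rewrite scaleN1r [- _ + _]addrC.
- by rewrite hdiffB dc dc' subrr.
Qed.

HB.instance Definition _ p q :=
  GRing.isZmodClosed.Build (cochain p) (@is_cocycle p q)
    (@is_cocycle_zmod_closed p q).

Record cocycle p q :=
  Cocycle { cocycle_val :> cochain p; _ : cocycle_val \in @is_cocycle p q }.

HB.instance Definition _ p q := [isSub for @cocycle_val p q].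
HB.instance Definition _ p q := [Choice of cocycle p q by <:].
HB.instance Definition _ p q := [SubChoice_isSubZmodule of cocycle p q by <:].

Definition coboundaries p (q : int) : set (cochain p) :=
  match p with
  | 0 => [set 0]
  | p'.+1 => [set hdiff g | g in @cochains p' q]
  end.

Definition is_coboundary p q : {pred cocycle p q} :=
  fun z => `[< coboundaries q (cocycle_val z) >].
Arguments is_coboundary p q _ /.

Lemma is_coboundary_zmod_closed p q : zmod_closed (@is_coboundary p q).
Proof.
case: p => [|p]; split=> [|z z'].
- by apply/asboolP.
- by move=> /asboolP/= z0 /asboolP/= z0'; apply/asboolP; rewrite /= z0 z0' subrr.
- have [] := @is_cocycle_zmod_closed p q => /asboolP[C0 d0] _.
  by apply/asboolP; exists 0.
- move=> /asboolP[g gC gz] /asboolP[g' gC' gz']; apply/asboolP.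
  exists (g - g'); last by rewrite hdiffB gz gz'.
  have [lg hg] := gC; have [lg' hg'] := gC'; split.
  + move=> i x r y t; rewrite -[LHS]/(g _ - g' _) lg lg'.
    rewrite -[in RHS]/(r *: (g _ - g' _) + (g _ - g' _)).
    by rewrite scalerBr opprD addrACA.
  + move=> n x xn; have [_ /(_ (-1))] := grading_submod gB (\sum_i n i + q).
    move=> /(_ _ _ (hg' n x xn) (hg n x xn)).
    by rewrite scaleN1r [- _ + _]addrC.
Qed.

HB.instance Definition _ p q :=
  GRing.isZmodClosed.Build (cocycle p q) (@is_coboundary p q)
    (@is_coboundary_zmod_closed p q).

Definition HH p q := Quotient.quot (@is_coboundary p q).
HB.instance Definition _ p q := GRing.Zmodule.on (HH p q).

(* The class of a cocycle of bidegree (p, q); the junk value is 0. *)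
Definition hclass p q (c : cochain p) : HH p q :=
  \pi_(HH p q) (insubd (0 : cocycle p q) c).

Definition const (z : B) : cochain 0 := fun=> z.

Definition cup p s (c1 : cochain p) (c2 : cochain s) : cochain (p + s) :=
  fun x => c1 (x \o lshift s) * c2 (x \o @rshift p s).

Fixpoint cup_exp (c : cochain 1) n : cochain n :=
  match n with
  | 0 => const 1
  | n'.+1 => cup c (@cup_exp c n')
  end.

Definition normalised p (c : cochain p) :=
  forall x i, x i = 1 -> c x = 0.

End Hochschild.

Arguments cup_exp {k A B} c n x : rename.

Section GerstenhaberSquare.
Variables (k : fieldType) (B : algType k) (gB : grading B).

(* The insertion of c at the place i of c receives the arguments i, ..., i + p,
   where the arity of c is p + 1. *)
Definition gsquare p (c : ('I_p.+1 -> B) -> B) : ('I_(p + p).+1 -> B) -> B :=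
  fun x => \sum_(i < p.+1) c (fun l =>
    if (l < i)%N then x (inord l)
    else if l == i then c (fun m => x (inord (i + m)))
    else x (inord (l + p))).

(* Sq, restriction and BV are defined on classes through a representative; as
   the cochain operations are compatible with the Hochschild differential (for
   BV, on normalised cochains), the choice of the representative is immaterial. *)
Definition Sq p q (x : HH idfun gB gB p.+1 q) :
    HH idfun gB gB (p + p).+1 (q + q) :=
  hclass idfun gB gB (q + q) (gsquare (cocycle_val (repr x))).

End GerstenhaberSquare.

Definition restriction (k : fieldType) (A B : algType k) (j : A -> B)
    (gA : grading A) (gB : grading B) p q (x : HH idfun gB gB p q) :
    HH j gA gB p q :=
  hclass j gA gB q (fun a => cocycle_val (repr x) (j \o a)).

Section BatalinVilkovisky.
Variables (k : fieldType) (B : algType k) (gB : grading B).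

Definition graded_dual (psi : B -> k) :=
  (forall c x y, psi (c *: x + y) = c * psi x + psi y) /\
  (exists s : seq int, forall n x, n \notin s -> gB n x -> psi x = 0).

(* The bimodule structure of the dual is (x . psi . z)(t) = psi (z * t * x). *)
Definition graded_bimodule_iso (phi : B -> B -> k) :=
  [/\ forall c x y t, phi (c *: x + y) t = c * phi x t + phi y t,
      forall n m x y, n + m != 0 -> gB n x -> gB m y -> phi x y = 0,
      forall x y z t, phi (x * y * z) t = phi y (z * t * x),
      forall x, graded_dual (phi x) &
      forall psi, graded_dual psi -> exists! x, phi x = psi].

Variable phi : B -> B -> k.

(* In X (i + l) the addition is that of 'I_p.+1, i.e. modulo p + 1. *)
Definition BV_cochain p (c : ('I_p.+1 -> B) -> B) : ('I_p -> B) -> B := fun x =>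
  xget 0 [set w | forall y,
    let X l := if unlift ord_max l is Some l' then x l' else y in
    phi w y = \sum_(i < p.+1) phi (c (fun l => X (i + l))) 1].

Definition BV p q (x : HH idfun gB gB p.+1 q) : HH idfun gB gB p q :=
  hclass idfun gB gB q (BV_cochain (cocycle_val (xget 0
    [set c | normalised (cocycle_val c) /\ \pi_(HH idfun gB gB p.+1 q) c = x]))).

End BatalinVilkovisky.

Notation Lam k := {poly %/ ('X^2 : {poly k})}.
Notation bLam k := (laurent (Lam k)).

Section LaurentLam.
Variable k : fieldType.

Definition eps : Lam k := 'qX.

(* x`_0 and x`_1 are the coordinates of x in the basis 1, eps. *)
Definition pairing (a b : k) (x y : Lam k) : k :=
  let: (x, y) := (x : {poly k}, y : {poly k}) in
  x`_0 * y`_0 * a + (x`_0 * y`_1 + x`_1 * y`_0) * b.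

Definition imath : bLam k := lmono 1 1.
Definition incl (x : Lam k) : bLam k := lmono 0 x.

Definition Lam_piece (n : int) : set (Lam k) := [set x | x != 0 -> n = 0].
Definition bLam_piece (d : nat) (n : int) : set (bLam k) :=
  [set f | forall m, f m != 0 -> n = - (d%:Z * m)].

Lemma Lam_piece_submod n : Lam_piece n 0 /\
  forall (c : k) x y, Lam_piece n x -> Lam_piece n y -> Lam_piece n (c *: x + y).
Proof.
split=> [|c x y nx ny]; first by rewrite /Lam_piece /= eqxx.
have [->|/nx ->] := eqVneq x 0; first by rewrite scaler0 add0r.
by [].
Qed.

Lemma bLam_piece_submod d n : bLam_piece d n 0 /\
  forall (c : k) x y,
    bLam_piece d n x -> bLam_piece d n y -> bLam_piece d n (c *: x + y).
Proof.
split=> [m|c x y nx ny m]; first by rewrite fsfun0E eqxx.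
rewrite laddE lscaleE; have [xm|/nx-> //] := eqVneq (x m) 0.
by rewrite xm scaler0 add0r => /ny.
Qed.

Definition Lam_grading : grading (Lam k) := Grading Lam_piece_submod.
Definition bLam_grading d : grading (bLam k) := Grading (bLam_piece_submod d).

Definition uLam : ('I_1 -> Lam k) -> Lam k := fun x => (x ord0 : {poly k})`_1 *: 1.
(* the derivation with eps |-> 1 and imath |-> 0 *)
Definition ubLam : ('I_1 -> bLam k) -> bLam k := fun x =>
  [fsfun n in finsupp (x ord0) => uLam (fun=> x ord0 n)].

Definition phi (a b : k) (f g : bLam k) : k :=
  \sum_(n <- finsupp f) pairing a b (f n) (g (- n)).

End LaurentLam.

Notation HHbLam k d p q :=
  (HH (@idfun (bLam k)) (bLam_grading k d) (bLam_grading k d) p q).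
Notation HHLamb k d p q :=
  (HH (@incl k) (Lam_grading k) (bLam_grading k d) p q).

Section Classes.
Variables (k : fieldType) (d : nat).

(* the class of z . u ^ n, where z has degree -d *)
Definition class_u (z : bLam k) n : HHbLam k d n (- d%:Z) :=
  hclass _ _ _ _ (cup (const z) (cup_exp (@ubLam k) n)).

Definition imath_cup n (eta : ('I_n -> Lam k) -> Lam k) : HHLamb k d n (- d%:Z) :=
  hclass _ _ _ _ (cup (const (imath k)) (@incl k \o eta)).

Definition associated_class n (eta : ('I_n.+1 -> Lam k) -> Lam k)
    (m : HHbLam k d n.+1 (- d%:Z)) :=
  unique (fun m' : HHbLam k d n.+1 (- d%:Z) =>
    Sq m' = 0 /\ restriction (@incl k) (Lam_grading k) m' = imath_cup eta) m.

End Classes.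

(* phi a b is indeed an isomorphism of graded bimodules. *)
Section PhiIso.
Variables (k : fieldType) (d : nat) (a b : k).
Implicit Types (x y z : Lam k) (f g h : bLam k).

Lemma size_Lam x : (size (x : {poly k}) <= 2)%N.
Proof.
rewrite -ltnS; apply: leq_trans (size_mk_monic x) _.
by rewrite mk_monic_Xn size_polyXn.
Qed.

Lemma LamP x y :
  (x : {poly k})`_0 = (y : {poly k})`_0 ->
  (x : {poly k})`_1 = (y : {poly k})`_1 -> x = y.
Proof.
move=> e0 e1; apply: val_inj; apply/polyP => -[|[|n]] //.
by rewrite !nth_default // (leq_trans (size_Lam _)).
Qed.

Lemma Lam_mul x y :
  ((x * y : Lam k) : {poly k})`_0 = (x : {poly k})`_0 * (y : {poly k})`_0 /\
  ((x * y : Lam k) : {poly k})`_1 =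
    (x : {poly k})`_0 * (y : {poly k})`_1 + (x : {poly k})`_1 * (y : {poly k})`_0.
Proof.
rewrite poly_of_qpolyM; set p := (x : {poly k}) * _.
rewrite (_ : Pdiv.CommonRing.rmodp p _ = take_poly 2 p); last first.
  rewrite mk_monic_Xn /= -[p in LHS](poly_take_drop 2) addrC.
  rewrite Pdiv.RingMonic.rmodp_addl_mul_small ?monicXn //.
  by rewrite size_polyXn ltnS size_take_poly.
rewrite !coef_take_poly /= /p !coefM !big_ord_recl !big_ord0 /=.
by rewrite !addr0.
Qed.

Lemma pairingDr x c y z :
  pairing a b x (c *: y + z) = c * pairing a b x y + pairing a b x z.
Proof. by rewrite /pairing /= !coefD !coefZ; ring. Qed.

Lemma pairingDl c x y z :
  pairing a b (c *: x + y) z = c * pairing a b x z + pairing a b y z.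
Proof. by rewrite /pairing /= !coefD !coefZ; ring. Qed.

Lemma pairing0r x : pairing a b x 0 = 0.
Proof. by rewrite /pairing /= !coef0; ring. Qed.

Lemma pairing0l x : pairing a b 0 x = 0.
Proof. by rewrite /pairing /= !coef0; ring. Qed.

Lemma eps0 : (eps k : {poly k})`_0 = 0.
Proof. by rewrite qpolyXE ?size_polyXn ?monicXn // coefX. Qed.

Lemma eps1 : (eps k : {poly k})`_1 = 1.
Proof. by rewrite qpolyXE ?size_polyXn ?monicXn // coefX. Qed.

Lemma pairing_1 x :
  pairing a b x 1 = (x : {poly k})`_0 * a + (x : {poly k})`_1 * b.
Proof. by rewrite /pairing /= !coefC /=; ring. Qed.

Lemma pairing_eps x : pairing a b x (eps k) = (x : {poly k})`_0 * b.
Proof. by rewrite /pairing eps0 eps1; ring. Qed.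

Lemma pairing_basis x y : pairing a b x y =
  (y : {poly k})`_0 * pairing a b x 1 + (y : {poly k})`_1 * pairing a b x (eps k).
Proof. by rewrite pairing_1 pairing_eps /pairing; ring. Qed.

Lemma pairing_mul x y : pairing a b x y = pairing a b (x * y) 1.
Proof.
rewrite /pairing; have [-> ->] := Lam_mul x y.
by rewrite /= !coefC /=; ring.
Qed.

Lemma pairing1_sum I (r : seq I) (F : I -> Lam k) :
  pairing a b (\sum_(i <- r) F i) 1 = \sum_(i <- r) pairing a b (F i) 1.
Proof.
elim: r => [|i r IH]; first by rewrite !big_nil pairing0l.
by rewrite !big_cons -[F i]scale1r pairingDl mul1r scale1r IH.
Qed.

Lemma phi_coef f g : phi a b f g = pairing a b ((f * g : bLam k) 0) 1.
Proof.
rewrite lmulE pairing1_sum; apply: eq_bigr => i _.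
by rewrite sub0r pairing_mul.
Qed.

Lemma phi_lmono f n y : phi a b f (lmono (- n) y) = pairing a b (f n) y.
Proof.
rewrite /phi; have [fn|] := boolP (n \in finsupp f).
  rewrite (big_fsetD1 n) //= lmonoE eqxx big_seq big1 ?addr0 // => i.
  rewrite in_fsetD1 => /andP[ni _].
  by rewrite lmonoE (inj_eq oppr_inj) (negPf ni) pairing0r.
move=> nf; have := nf; rewrite memNfinsupp => /eqP ->.
rewrite pairing0l big_seq big1 // => i fi; rewrite lmonoE (inj_eq oppr_inj).
by case: eqP => [ni|_]; [rewrite -ni fi in nf | rewrite pairing0r].
Qed.

Lemma phi_linearl c f g h :
  phi a b (c *: f + g) h = c * phi a b f h + phi a b g h.
Proof. by rewrite !phi_coef mulrDl -scalerAl laddE lscaleE pairingDl. Qed.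

Lemma phi_linearr c f g h :
  phi a b f (c *: g + h) = c * phi a b f g + phi a b f h.
Proof. by rewrite !phi_coef mulrDr -scalerAr laddE lscaleE pairingDl. Qed.

Lemma lmono_sum f : f = \sum_(n <- finsupp f) lmono n (f n).
Proof.
apply: laurentP => m.
rewrite (big_morph (fun g : bLam k => g m) (id1 := 0) (op1 := +%R)); last 2 first.
- by move=> g h; rewrite laddE.
- by rewrite fsfun0E.
have [fm|] := boolP (m \in finsupp f).
  rewrite (big_fsetD1 m) //= lmonoE eqxx big_seq big1 ?addr0 // => i.
  by rewrite in_fsetD1 => /andP[mi _]; rewrite lmonoE eq_sym (negPf mi).
move=> mf; have := mf; rewrite memNfinsupp => /eqP ->.
rewrite big_seq big1 // => i fi; rewrite lmonoE.
by case: eqP => // mi; rewrite mi fi in mf.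
Qed.

Lemma graded_dual_phi f : graded_dual (bLam_grading k d) (phi a b f).
Proof.
split=> [c g h|]; first exact: phi_linearr.
exists [seq d%:Z * i | i <- finsupp f] => n g ns ng.
rewrite /phi big_seq big1 // => i fi.
have [->|/ng] := eqVneq (g (- i)) 0; first by rewrite pairing0r.
rewrite mulrN opprK => nE; case/negP: ns; apply/mapP.
by exists i.
Qed.

Lemma phi_inj f g : b != 0 -> phi a b f = phi a b g -> f = g.
Proof.
move=> b0 fg; apply: laurentP => n.
have E y : pairing a b (f n) y = pairing a b (g n) y.
  by rewrite -!phi_lmono fg.
have e0 : (f n : {poly k})`_0 = (g n : {poly k})`_0.
  by apply: (mulIf b0); have := E (eps k); rewrite !pairing_eps.
apply: LamP => //; apply: (mulIf b0); have := E 1.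
by rewrite !pairing_1 e0 => /addrI.
Qed.

Lemma phi_surj (psi : bLam k -> k) : b != 0 -> (0 < d)%N ->
  graded_dual (bLam_grading k d) psi -> exists f, phi a b f = psi.
Proof.
move=> b0 d0 [psi_lin [s psi_s]].
have d_neq0 : d%:Z != 0 by rewrite eqz_nat -lt0n.
pose w0 n := psi (lmono (- n) (eps k)) / b.
pose w1 n := (psi (lmono (- n) 1) - a * w0 n) / b.
pose f : bLam k := [fsfun n in [fset (m %/ d%:Z)%Z | m in s]%fset =>
  w0 n *: 1 + w1 n *: eps k].
have psi0 : psi 0 = 0.
  by have := psi_lin (-1) 0 0; rewrite scaler0 add0r mulN1r addNr.
have psi_sum I (r : seq I) (F : I -> bLam k) :
    psi (\sum_(i <- r) F i) = \sum_(i <- r) psi (F i).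
  elim: r => [|i r IH]; first by rewrite !big_nil psi0.
  by rewrite !big_cons -[F i]scale1r psi_lin mul1r scale1r IH.
have phi_sum I (r : seq I) (F : I -> bLam k) :
    phi a b f (\sum_(i <- r) F i) = \sum_(i <- r) phi a b f (F i).
  elim: r => [|i r IH].
    by rewrite !big_nil phi_coef mulr0 fsfun0E pairing0l.
  by rewrite !big_cons -[F i]scale1r phi_linearr mul1r scale1r IH.
exists f; apply/funext => g; rewrite (lmono_sum g) phi_sum psi_sum.
apply: eq_bigr => m _; rewrite -[m]opprK phi_lmono; move: (- m) (g _) => n y.
have yE : y = (y : {poly k})`_0 *: 1 + (y : {poly k})`_1 *: eps k.
  apply: LamP; rewrite [RHS]coefD !coefZ ?eps0 ?eps1 coefC /=.
    by rewrite mulr0 mulr1 addr0.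
  by rewrite mulr0 mulr1 add0r.
have -> : lmono (- n) y = (y : {poly k})`_0 *: lmono (- n) 1
    + (y : {poly k})`_1 *: lmono (- n) (eps k) :> bLam k.
  apply: laurentP => m'; rewrite laddE !lscaleE !lmonoE.
  by case: eqP => _; rewrite ?scaler0 ?addr0 // -yE.
have psiN z : n \notin [fset (m %/ d%:Z)%Z | m in s]%fset ->
    psi (lmono (- n) z) = 0.
  move=> ns; apply: (psi_s (d%:Z * n)).
    apply: contra ns => ns; apply/imfsetP; exists (d%:Z * n) => //=.
    by rewrite mulKz.
  by move=> m'; rewrite lmonoE; case: (m' =P - n) => [-> _|_]; rewrite ?eqxx ?mulrN ?opprK.
rewrite -[_ *: lmono _ (eps k)]addr0 !psi_lin psi0 addr0.
rewrite fsfun_fun; case: ifP => [_|/negbT ns]; last first.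
  by rewrite !psiN // !mulr0 addr0 pairing0l.
rewrite pairing_basis pairing_1 pairing_eps.
rewrite !coefD !coefZ eps0 eps1 !coefC /= !(mulr0, mulr1, addr0, add0r).
congr (_ * _ + _ * _); last by rewrite /w0 divfK.
by rewrite /w1 divfK // mulrC addrC subrK.
Qed.

Lemma phi_graded_bimodule_iso : (0 < d)%N -> b != 0 ->
  graded_bimodule_iso (bLam_grading k d) (phi a b).
Proof.
move=> d0 b0; split.
- by move=> c f g h; apply: phi_linearl.
- move=> n m f g nm fn gm; rewrite /phi big_seq big1 // => i fi.
  have [->|/gm mE] := eqVneq (g (- i)) 0; first by rewrite pairing0r.
  have [->|/fn nE] := eqVneq (f i) 0; first by rewrite pairing0l.
  by rewrite nE mE mulrN opprK addNr eqxx in nm.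
- move=> f g h t; rewrite !phi_coef; congr (pairing a b (_ 0) 1).
  by rewrite -!mulrA mulrC -!mulrA.
- exact: graded_dual_phi.
- move=> psi /(phi_surj b0 d0)[f fpsi]; exists f; split=> // g gpsi.
  by apply: (phi_inj b0); rewrite fpsi gpsi.
Qed.

End PhiIso.

(* Main.v *)
From mathcomp Require Import all_boot all_order all_algebra.
From mathcomp Require Import ring_quotient generic_quotient finmap.
From mathcomp Require Import boolp classical_sets functions.
From mathcomp Require Import zify ring.
Require Import Defs.

(** The class of imath . u ^ n is represented by an explicit cocycle: the product
    of imath with the values of the derivation u at the n arguments.  On this
    representative every operation of the statement is an exact computation, so
    the work is in showing that the operations do not see the choice of
    representative.

    - The Gerstenhaber square.  All values of u are killed by u, hence the square
      of the explicit cocycle c is zero on the nose ([scomp_ucochain]).  A class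
      is only known through some c + dg, and Gerstenhaber's formula
      d (f o g) = df o g + f o dg + f . g + g . f ([sdiff_scomp]) shows that the
      square of c + dg differs from the one of c by the boundary of
      c o g + g o c + g o dg + g . g ([gsquare_coboundary]).  Since the
      restriction of c along Lam is imath . eta, the class of c has the two
      defining properties of the class associated with eta.

    - The Batalin-Vilkovisky operator.  Let tau x = phi x 1, a trace.  The
      operator sends f to the cochain h such that tau (h (x_1, .., x_p) y) is
      the sum of tau o f over all rotations of the cyclic word (x_1, .., x_p, y).
      In characteristic 2 this commutes with the differential on all cochains
      ([cyclic_trace_sdiff]): on both sides one fuses two adjacent letters of a
      cyclic word and cuts it at another place ([sum_rotate_fuse]), and the
      two families of remaining terms of the differential coincide up to a
      rotation, so they cancel.  Hence the value on a class may be computed on c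
      ([BV_hclass]).

    - The value on c.  The cochain c is symmetric, so the d + 2 rotations
      contribute equal terms, and their sum vanishes when d is even.  When d is
      odd a single term phi (f . u y) 1 is left, where f is the product of imath
      and the u x_i; it has to be written as phi (w . f) y, i.e. one needs the
      adjoint of u for the pairing ([trace_adjoint]).  Solving the equations
      for y = 1 and y = eps gives w = a / b + (a / b) ^ 2 eps.

    - Non-vanishing.  The class of z . u ^ n is zero only if z is: every
      coboundary vanishes at (eps, .., eps), because eps ^ 2 = 0 and the two
      outer terms of the differential agree ([sdiff_eps]), while the cocycle
      takes the value z there.

    The identities about faces, insertions and rotations are proved for
    functions of infinite sequences that depend on finitely many entries: indices
    are then plain natural numbers, and arities need no casts. *)

Set Implicit Arguments.
Unset Strict Implicit.
Unset Printing Implicit Defensive.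

Import GRing.Theory.
Local Open Scope ring_scope.
Local Open Scope quotient_scope.

(** * Cochains on infinite sequences and their operations *)

Definition shift T (k : nat) (X : nat -> T) : nat -> T := fun l => X (k + l)%N.

Section StreamCochains.
Variables (k : fieldType) (B : algType k).
Implicit Types (X Y : nat -> B) (f g : (nat -> B) -> B).

Definition fuse i X : nat -> B := fun l =>
  if (l < i)%N then X l else if l == i then X i * X i.+1 else X l.+1.

(** The arguments of an outer cochain after a value computed from the entries
    i, .., i + q has been put at the place i. *)
Definition put (q i : nat) (v : B) X : nat -> B :=
  [eta (fun l => if (l < i)%N then X l else X (l + q)%N) with i |-> v].

Definition sdiff p f : (nat -> B) -> B := fun X =>
  X 0%N * f (shift 1 X) + \sum_(0 <= i < p) f (fuse i X) + f X * X p.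

Definition scup p f g : (nat -> B) -> B := fun X => f X * g (shift p X).

Definition scomp p q f g : (nat -> B) -> B := fun X =>
  \sum_(0 <= i < p) f (put q i (g (shift i X)) X).

(** Being a function of p arguments. *)
Definition slocal p f := forall X Y, (forall l, (l < p)%N -> X l = Y l) -> f X = f Y.

Definition smultilinear p f := forall i X (r : k) y z, (i < p)%N ->
  f [eta X with i |-> r *: y + z] =
    r *: f [eta X with i |-> y] + f [eta X with i |-> z].

Lemma smultilinearD p f i X y z : smultilinear p f -> (i < p)%N ->
  f [eta X with i |-> y + z] = f [eta X with i |-> y] + f [eta X with i |-> z].
Proof. by move=> lf ip; have := lf i X 1 y z ip; rewrite !scale1r. Qed.

Lemma smultilinear0 p f i X : smultilinear p f -> (i < p)%N ->
  f [eta X with i |-> 0] = 0.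
Proof.
move=> lf ip; apply: (addrI (f [eta X with i |-> 0])).
by rewrite addr0 -(smultilinearD _ _ _ lf) // addr0.
Qed.

Lemma smultilinear_sum p f i X I (r : seq I) (F : I -> B) :
  smultilinear p f -> (i < p)%N ->
  f [eta X with i |-> \sum_(j <- r) F j] = \sum_(j <- r) f [eta X with i |-> F j].
Proof.
move=> lf ip; elim: r => [|j r IH]; first by rewrite !big_nil (smultilinear0 _ lf).
by rewrite !big_cons (smultilinearD _ _ _ lf) // IH.
Qed.

(** Double sums over i <= p and j < p split along the diagonal: j < i is
    reindexed by i - 1, and j >= i is kept. *)
Lemma sum_triangles (V : nmodType) p (M : nat -> nat -> V) :
  \sum_(0 <= i < p.+1) \sum_(0 <= j < p) M j i =
  \sum_(0 <= i < p) (\sum_(0 <= j < i.+1) M j i.+1 + \sum_(i <= j < p) M j i).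
Proof.
transitivity (\sum_(0 <= i < p.+1)
    (\sum_(0 <= j < i) M j i + \sum_(i <= j < p) M j i)).
  by apply: eq_big_nat => i ip; rewrite (big_cat_nat (n := i)) //=; lia.
rewrite !big_split /=; congr (_ + _).
  by rewrite big_nat_recl // big_nil add0r.
by rewrite big_nat_recr //= [X in _ + X]big_geq // addr0.
Qed.

Lemma sum_nat_addl (V : nmodType) a n (F : nat -> V) :
  \sum_(a <= i < a + n) F i = \sum_(0 <= i < n) F (a + i)%N.
Proof.
rewrite -{1}[a]add0n big_addn addKn.
by apply: eq_bigr => i _; rewrite addnC.
Qed.

Hypothesis B2 : 2%N \in [pchar B].

Lemma sdiff_scup p q f g X : slocal p f ->
  sdiff (p + q) (scup p f g) X =
  scup p.+1 (sdiff p f) g X + scup p f (sdiff q g) X.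
Proof.
move=> lf; rewrite /scup /sdiff.
rewrite (big_cat_nat (n := p)) ?leq_addr //= (sum_nat_addl p).
have -> : \sum_(0 <= i < p) f (fuse i X) * g (shift p (fuse i X)) =
    \sum_(0 <= i < p) f (fuse i X) * g (shift p.+1 X).
  apply: eq_big_nat => i ip; congr (_ * g _); apply/funext => l.
  by rewrite /shift /fuse; do !case: ifP => ?; try lia.
have -> : \sum_(0 <= i < q) f (fuse (p + i) X) *
      g (shift p (fuse (p + i) X)) =
    \sum_(0 <= i < q) f X * g (fuse i (shift p X)).
  apply: eq_big_nat => i ip; congr (_ * g _).
    by apply: lf => l lp; rewrite /fuse; do !case: ifP => ?; try lia.
  apply/funext => l; rewrite /shift /fuse.
  by rewrite eqn_add2l ltn_add2l !addnS.
rewrite -mulr_suml -mulr_sumr !mulrDl !mulrDr.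
have -> : shift 1 (shift p X) = shift p.+1 X.
  by apply/funext => l; rewrite /shift; congr X; lia.
have -> : shift p (shift 1 X) = shift p.+1 X.
  by apply/funext => l; rewrite /shift; congr X; lia.
rewrite -[shift p X q]/(X (p + q)%N) (_ : shift p X 0%N = X p); last first.
  by rewrite /shift addn0.
rewrite !mulrA -!addrA; do 2!congr (_ + _).
by rewrite [RHS]addrA addrr_pchar2 // add0r.
Qed.

(** Gerstenhaber's formula.  A face of a composite at j acts before the inserted
    block, inside it or after it.  The faces inside, together with the two ends
    of dg, give f o dg; those outside give df o g, up to the faces of f that
    touch the block.  The latter are the ends of dg, and for the first and the
    last block they are the two cup products. *)
Lemma sdiff_scomp p q f g X :
  slocal p f -> slocal q.+1 g -> smultilinear p f ->
  sdiff (p + q) (scomp p q f g) X =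
  scomp p.+1 q (sdiff p f) g X + scomp p q.+1 f (sdiff q.+1 g) X
  + scup p f g X + scup q.+1 g f X.
Proof.
move=> lf lg mf.
pose ins i := put q i (g (shift i X)) X.
pose M j i := f (fuse j (ins i)).
pose E i := \sum_(0 <= j < q.+1) f (put q.+1 i (g (fuse j (shift i X))) X).
pose L i := \sum_(0 <= j < i) M j i.+1.
pose H i := \sum_(i.+1 <= j < p) M j i.
pose a := X 0%N * \sum_(0 <= i < p) f (ins i.+1 \o succn).
pose z := (\sum_(0 <= i < p) f (ins i)) * X (p + q)%N.
(* The three summands of the middle sum: faces before, inside and after the
   block inserted at i. *)
have lhs : sdiff (p + q) (scomp p q f g) X =
    a + \sum_(0 <= i < p) (L i + (E i + H i)) + z.
  rewrite /sdiff; congr (_ + _ + _).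
  rewrite exchange_big; apply: eq_big_nat => i ip.
  rewrite (big_cat_nat (n := i)) //=; last lia.
  rewrite (big_cat_nat (n := (i + q.+1)%N) (m := i)) //=; try lia.
  congr (_ + (_ + _)).
  - apply: eq_big_nat => j ji; rewrite /M; congr f; apply/funext => l.
    rewrite /ins /put /fuse /=.
    have -> : shift i (fun l => if (l < j)%N then X l else
        if l == j then X j * X j.+1 else X l.+1) = shift i.+1 X.
      by apply/funext => m; rewrite /shift; do !case: ifP => ?; try lia; congr X; lia.
    do !case: ifP => ?; try lia; try done; congr X; lia.
  - rewrite (sum_nat_addl i); apply: eq_big_nat => j ji.
    congr f; apply/funext => l; rewrite /put /=; case: ifP => il.
      congr g; apply/funext => m; rewrite /shift /fuse.
      by rewrite eqn_add2l ltn_add2l !addnS.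
    rewrite /fuse; do !case: ifP => ?; try lia; congr X; lia.
  - rewrite (_ : (i + q.+1)%N = (i.+1 + q)%N); last lia.
    rewrite big_addn addnK; apply: eq_big_nat => j ji.
    rewrite /M; congr f; apply/funext => l; rewrite /ins /put /fuse /=.
    have -> : g (shift i (fun l => if (l < j + q)%N then X l else
        if l == (j + q)%N then X (j + q)%N * X (j + q).+1 else X l.+1)) = g (shift i X).
      by apply: lg => m mq; rewrite /shift; do !case: ifP => ?; try lia.
    do !case: ifP => ?; try lia; try done; try congr (_ * _); congr X; lia.
have inner : scomp p q.+1 f (sdiff q.+1 g) X =
    \sum_(0 <= i < p) (M i i.+1 + (E i + M i i)).
  apply: eq_big_nat => i ip.
  have mD := smultilinearD _ _ _ mf ip.
  rewrite /put /sdiff !mD (smultilinear_sum _ _ _ mf ip) -!addrA.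
  congr (_ + (_ + _)); rewrite /M; congr f; apply/funext => l.
    rewrite /ins /put /fuse /shift /= addn0.
    do !case: ifP => ?; try lia; try done; try congr (_ * _); try congr X; try lia.
      by congr g; apply/funext => m; congr X; lia.
  rewrite /ins /put /fuse /shift /=.
  do !case: ifP => ?; try lia; try done; try congr (_ * _); congr X; lia.
have outer : scomp p.+1 q (sdiff p f) g X =
    scup q.+1 g f X + a + \sum_(0 <= i < p) (L i + M i i.+1 + (M i i + H i))
    + (z + scup p f g X).
  transitivity (\sum_(0 <= i < p.+1) (ins i 0%N * f (shift 1 (ins i)))
     + \sum_(0 <= i < p.+1) \sum_(0 <= j < p) M j i
     + \sum_(0 <= i < p.+1) f (ins i) * ins i p).
    by rewrite -!big_split.
  rewrite sum_triangles; congr (_ + _ + _).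
  - rewrite big_nat_recl //; congr (_ * f _ + _).
      by apply/funext => l; rewrite /ins /put /shift /=; congr X; lia.
    rewrite /a mulr_sumr; apply: eq_big_nat => i ip; congr (_ * f _).
  - apply: eq_big_nat => i ip; rewrite big_nat_recr //=; congr (_ + _).
    by rewrite big_ltn; last lia.
  - rewrite big_nat_recr //=; congr (_ + _ * _).
    + rewrite /z mulr_suml; apply: eq_big_nat => i ip; congr (_ * _).
      by rewrite /ins /put /=; do !case: ifP => ?; try lia.
    + by apply: lf => l lp; rewrite /ins /put /=; do !case: ifP => ?; try lia.
    + by rewrite /ins /put /= eqxx.
rewrite lhs inner outer.
have -> : \sum_(0 <= i < p) (L i + (E i + H i)) =
    \sum_(0 <= i < p) (L i + M i i.+1 + (M i i + H i)) +
    \sum_(0 <= i < p) (M i i.+1 + (E i + M i i)).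
  rewrite -big_split; apply: eq_bigr => i _ /=.
  rewrite !addrA [RHS](ACl (1*6*4*(2*5)*(3*7)))%AC /=.
  by rewrite !addrr_pchar2 // !addr0.
set S1 := \sum_(_ <= _ < _) _; set S2 := \sum_(_ <= _ < _) _.
rewrite !addrA [RHS](ACl (2*3*6*4*(1*8)*(5*7)))%AC /=.
by rewrite !addrr_pchar2 // !addr0.
Qed.

End StreamCochains.

(** * Multilinear homogeneous cochains *)

Section StreamClosure.
Variables (k : fieldType) (B : algType k) (gB : grading B).
Implicit Types (X Y : nat -> B) (f g : (nat -> B) -> B).

Definition shomogeneous p (r : int) f := forall (n : nat -> int) X,
  (forall l, (l < p)%N -> gB (n l) (X l)) -> gB (\sum_(0 <= l < p) n l + r) (f X).

Definition scochain p r f :=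
  [/\ slocal p f, smultilinear p f & shomogeneous p r f].

Lemma grading0 n : gB n 0. Proof. by case: (grading_submod gB n). Qed.

Lemma gradingD n x y : gB n x -> gB n y -> gB n (x + y).
Proof.
by case: (grading_submod gB n) => _ /(_ 1 x y); rewrite scale1r.
Qed.

Lemma grading_sum n I (r : seq I) (P : pred I) (F : I -> B) :
  (forall i, P i -> gB n (F i)) -> gB n (\sum_(i <- r | P i) F i).
Proof.
move=> gF; elim/big_ind: _ => //; [exact: grading0|exact: gradingD].
Qed.

Lemma scochainD p r f g :
  scochain p r f -> scochain p r g -> scochain p r (fun X => f X + g X).
Proof.
move=> [lf mf hf] [lg mg hg]; split.
- by move=> X Y XY; rewrite (lf X Y) // (lg X Y).
- by move=> i X c y z ip; rewrite mf // mg // scalerDr addrACA.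
- by move=> n X Xn; apply: gradingD; [apply: hf|apply: hg].
Qed.

Hypothesis gM : forall m n x y, gB m x -> gB n y -> gB (m + n) (x * y).

Lemma scochain_scup p q r s f g : scochain p r f -> scochain q s g ->
  scochain (p + q) (r + s) (scup p f g).
Proof.
move=> [lf mf hf] [lg mg hg]; split.
- move=> X Y XY; congr (_ * _); first by apply: lf => l lp; apply: XY; lia.
  by apply: lg => l lq; apply: XY; rewrite ltn_add2l.
- move=> i X c y z ipq; rewrite /scup; have [ip|pi] := ltnP i p.
    rewrite mf // mulrDl scalerAl.
    have E v : shift p [eta X with i |-> v] = shift p X.
      by apply/funext => l; rewrite /shift /=; case: eqP => //; lia.
    by rewrite !E.
  have E v : shift p [eta X with i |-> v] = [eta shift p X with (i - p)%N |-> v].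
    apply/funext => l; rewrite /shift /=.
    by rewrite (_ : (p + l == i)%N = (l == i - p)%N) //; lia.
  have F v : f [eta X with i |-> v] = f X.
    by apply: lf => l lp /=; case: eqP => //; lia.
  by rewrite !E !F mg ?mulrDr ?scalerAr //; lia.
- move=> n X Xn; rewrite (big_cat_nat (n := p)) ?leq_addr //= (sum_nat_addl p) addrACA.
  apply: gM; first by apply: hf => l lp; apply: Xn; lia.
  by apply: (hg (fun l => n (p + l)%N)) => l lq; apply: Xn; rewrite ltn_add2l.
Qed.

Lemma scochain_scomp p q r s f g : scochain p r f -> scochain q.+1 s g ->
  scochain (p + q) (r + s) (scomp p q f g).
Proof.
move=> [lf mf hf] [lg mg hg]; split.
- move=> X Y XY; apply: eq_big_nat => i ip; apply: lf => l lp; rewrite /put /=.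
  case: eqP => [_|il]; first by apply: lg => m mq; apply: XY; lia.
  by case: ifP => ?; apply: XY; lia.
- move=> m X c y z mpq; rewrite /scomp scaler_sumr -big_split /=.
  apply: eq_big_nat => i ip; have [mi|im] := ltnP m i.
    have S v : shift i [eta X with m |-> v] = shift i X.
      by apply/funext => l; rewrite /shift /=; case: eqP => //; lia.
    have E v : put q i (g (shift i X)) [eta X with m |-> v] =
        [eta put q i (g (shift i X)) X with m |-> v].
      by apply/funext => l; rewrite /put /=; repeat case: ifP => ?; try lia.
    by rewrite !S !E mf //; lia.
  have [miq|iqm] := leqP m (i + q).
    have S v : shift i [eta X with m |-> v] = [eta shift i X with (m - i)%N |-> v].
      apply/funext => l; rewrite /shift /=.
      by rewrite (_ : (i + l == m)%N = (l == m - i)%N) //; lia.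
    have E w v : put q i w [eta X with m |-> v] = put q i w X.
      by apply/funext => l; rewrite /put /=; repeat case: ifP => ?; try lia.
    by rewrite !S !E mg ?mf //; lia.
  have S v : g (shift i [eta X with m |-> v]) = g (shift i X).
    by apply: lg => l lq; rewrite /shift /=; case: eqP => //; lia.
  have E w v : put q i w [eta X with m |-> v] =
      [eta put q i w X with (m - q)%N |-> v].
    apply/funext => l; rewrite /put /=; repeat case: ifP => ?; try lia; try by [].
  by rewrite !S !E mf //; lia.
- move=> n X Xn; rewrite /scomp [\sum_(0 <= i < p) _]big_nat.
  apply: grading_sum => i ip.
  (* the degrees of the arguments of the outer cochain *)
  pose n' l := if l == i then \sum_(0 <= l < q.+1) n (i + l)%N + s
    else if (l < i)%N then n l else n (l + q)%N.
  have -> : \sum_(0 <= l < p + q) n l + (r + s) = \sum_(0 <= l < p) n' l + r.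
    rewrite [r + s]addrC addrA; congr (_ + _).
    rewrite (big_cat_nat (n := i)) //=; last lia.
    rewrite (big_cat_nat (n := (i + q.+1)%N) (m := i)) //=; try lia.
    rewrite [RHS](big_cat_nat (n := i)) //=; last lia.
    rewrite [X in _ = _ + X]big_ltn // -!addrA; congr (_ + _).
      apply: eq_big_nat => l li; rewrite /n'.
      by case: eqP => [|_]; [lia|case: ifP => //; lia].
    rewrite /n' eqxx (sum_nat_addl i) -!addrA; congr (_ + _).
    rewrite addrC; congr (_ + _).
    rewrite (_ : (i + q.+1)%N = (i.+1 + q)%N); last lia.
    rewrite big_addn addnK; apply: eq_big_nat => l li.
    by rewrite /n'; case: eqP => [|_]; [lia|case: ifP => //; lia].
  apply: hf => l lp; rewrite /n' /put /=; case: eqP => [_|li].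
    by apply: (hg (fun m => n (i + m)%N)) => m mq; apply: Xn; lia.
  by case: ifP => ?; apply: Xn; lia.
Qed.

End StreamClosure.

(** * Cyclic words and traces *)

(** Innermost tests first, so that a test is never an argument of another one;
    contradictory branches are dropped at once to keep their number small. *)
Ltac prune_ifs := repeat match goal with |- context [if ?b then _ else _] =>
  lazymatch b with
  | context [if _ then _ else _] => fail
  | _ => let bE := fresh "bE" in destruct b eqn:bE; try (exfalso; lia)
  end end.

Section Cyclic.
Lemma sum_nat_sub (V : nmodType) a b (F : nat -> V) : (a <= b)%N ->
  \sum_(a <= i < b) F i = \sum_(0 <= i < b - a) F (a + i)%N.
Proof. by move=> ab; rewrite -sum_nat_addl subnKC. Qed.
Variables (k : fieldType) (B : algType k).
Implicit Types (X Y : nat -> B) (f g : (nat -> B) -> B).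

Definition rotate n i X : nat -> B := fun l => X ((i + l) %% n)%N.

Lemma big_rotate (R : Type) (idx : R) (op : Monoid.com_law idx) n i (F : nat -> R) :
  \big[op/idx]_(0 <= l < n) F ((i + l) %% n)%N = \big[op/idx]_(0 <= l < n) F l.
Proof.
case: n => [|n]; first by rewrite !big_geq.
rewrite !big_mkord [RHS](reindex_inj (addrI (inord (i %% n.+1) : 'I_n.+1))) /=.
apply: eq_bigr => l _; rewrite inordK ?ltn_pmod //.
by rewrite modnDml.
Qed.

(** Both sides fuse two adjacent letters of a cyclic word of p + 2 letters and cut
    the word at one of the p + 1 places outside the fused pair.  On the left the
    cut i comes first; on the right the pair does, the pair of the last and the
    first letter being apart. *)
Lemma sum_rotate_fuse (V : zmodType) p (G : (nat -> B) -> V) X :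
  (forall X Y, (forall l, (l < p.+1)%N -> X l = Y l) -> G X = G Y) ->
  \sum_(0 <= i < p.+2) \sum_(0 <= j < p.+1) G (fuse j (rotate p.+2 i X)) =
  \sum_(0 <= i < p.+1) G (rotate p.+1 i [eta shift 1 X with p |-> X p.+1 * X 0%N])
  + \sum_(0 <= j < p.+1) \sum_(0 <= i < p.+1) G (rotate p.+1 i (fuse j X)).
Proof.
move=> lG; set Z := [eta _ with _ |-> _].
have modE n i l : (i < n)%N -> (l < n)%N ->
    ((i + l) %% n = if i + l < n then i + l else i + l - n)%N.
  move=> ip lp; case: ifP => il; first by rewrite modn_small.
  by rewrite -{1}[(i + l)%N](@subnK n) ?modnDr ?modn_small; lia.
pose N m i := G (rotate p.+1 i (fuse m X)).
pose A i := \sum_(i <= m < p.+1) N m i.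
(* For the cut i, the pairs to its right are counted by A i, the pair of the last
   and the first letter and those to its left by C i. *)
pose C i := if i is i'.+1 then G (rotate p.+1 i' Z) + \sum_(0 <= m < i') N m i' else 0.
have caseP (i : nat) : (i < p.+2)%N ->
    \sum_(0 <= j < p.+1) G (fuse j (rotate p.+2 i X)) = A i + C i.
  case: i => [|i] ip.
    rewrite addr0; apply: eq_big_nat => j jp; apply: lG => l lp.
    rewrite /rotate /fuse !add0n; do !rewrite modn_small; try lia.
    by repeat case: ifP => ? //; rewrite !modn_small; lia.
  rewrite (big_cat_nat (n := (p - i)%N)) //=; last lia.
  congr (_ + _).
    rewrite /A (@sum_nat_sub _ i.+1) // subSS.
    apply: eq_big_nat => j jp; apply: lG => l lp.
    rewrite /rotate /fuse.
    rewrite (modE p.+1); try lia.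
    rewrite ?modE; try lia; prune_ifs; do ?congr (_ * _); try congr X; lia.
  rewrite big_ltn; last lia.
  congr (_ + _).
    apply: lG => l lp; rewrite /rotate /fuse /Z /shift /=.
    rewrite (modE p.+1); try lia.
    rewrite ?modE; try lia; prune_ifs; do ?congr (_ * _); try congr X; lia.
  rewrite (@sum_nat_sub _ (p - i).+1) ?ltnS ?leq_subr // subSS subKn //.
  apply: eq_big_nat => j jp; apply: lG => l lp; rewrite /rotate /fuse.
  rewrite (modE p.+1); try lia.
  rewrite ?modE; try lia; prune_ifs; do ?congr (_ * _); try congr X; lia.
transitivity (\sum_(0 <= i < p.+2) (A i + C i)).
  by apply: eq_big_nat => i ip; rewrite caseP //; lia.
rewrite big_split /= big_nat_recr //= [in X in _ + X]big_nat_recl //=.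
rewrite (_ : A p.+1 = 0) ?(_ : C 0%N = 0) ?addr0 ?add0r //; last by rewrite /A big_geq.
rewrite exchange_big_nat -!big_split /=.
apply: eq_big_nat => i ip.
rewrite [in RHS](big_cat_nat (n := i)) //=; last lia.
by rewrite addrC -addrA.
Qed.

End Cyclic.

Section CyclicTrace.
Variables (k : fieldType) (B : algType k) (gB : grading B) (tau : B -> k).
Implicit Types (X Y : nat -> B) (f g : (nat -> B) -> B).

Hypothesis tau_lin : forall c x y, tau (c *: x + y) = c * tau x + tau y.
Hypothesis tauC : forall x y, tau (x * y) = tau (y * x).

Lemma traceD x y : tau (x + y) = tau x + tau y.
Proof. by have := tau_lin 1 x y; rewrite scale1r mul1r. Qed.

Lemma trace0 : tau 0 = 0.
Proof. by apply: (addrI (tau 0)); rewrite -traceD !addr0. Qed.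

Lemma trace_sum I (r : seq I) (F : I -> B) :
  tau (\sum_(i <- r) F i) = \sum_(i <- r) tau (F i).
Proof. exact: (big_morph tau traceD trace0). Qed.

Definition cyclic_trace n f X := \sum_(0 <= i < n) tau (f (rotate n i X)).

Lemma cyclic_trace_local n f X Y : slocal n f ->
  (forall l, (l < n)%N -> X l = Y l) -> cyclic_trace n f X = cyclic_trace n f Y.
Proof.
move=> lf XY; apply: eq_big_nat => i ni; congr tau; apply: lf => l ln.
by rewrite /rotate XY // ltn_pmod //; lia.
Qed.

Lemma cyclic_trace_multilinear n f i X (r : k) y z :
  slocal n f -> smultilinear n f -> (i < n)%N ->
  cyclic_trace n f [eta X with i |-> r *: y + z] =
    r * cyclic_trace n f [eta X with i |-> y] + cyclic_trace n f [eta X with i |-> z].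
Proof.
move=> lf mf ni; rewrite /cyclic_trace mulr_sumr -big_split /=.
apply: eq_big_nat => j jn.
pose m := if (j <= i)%N then (i - j)%N else (i + n - j)%N.
have E v : f (rotate n j [eta X with i |-> v]) = f [eta rotate n j X with m |-> v].
  apply: lf => l ln; rewrite /rotate /=.
  suff -> : ((j + l) %% n == i)%N = (l == m) by [].
  have [jl|jl] := ltnP (j + l) n.
    by rewrite modn_small // /m; case: ifP; lia.
  by rewrite -[(j + l)%N](@subnK n) // modnDr modn_small /m; [case: ifP|]; lia.
by rewrite !E mf ?tau_lin // /m; case: ifP; lia.
Qed.

(** A trace of degree 0 only sees words of total degree 0, whatever the rotation. *)
Lemma cyclic_trace_homogeneous n q f (N : nat -> int) X :
  (forall m x, m != 0 -> gB m x -> tau x = 0) -> shomogeneous gB n q f ->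
  (forall l, (l < n)%N -> gB (N l) (X l)) ->
  \sum_(0 <= l < n) N l + q != 0 -> cyclic_trace n f X = 0.
Proof.
move=> tau_deg hf XN Nq; apply: big1_seq => i /= /[!mem_index_iota] ni.
apply: (tau_deg _ _ Nq); rewrite -(big_rotate _ n i).
apply: (hf _ (rotate n i X)) => l ln.
by apply: XN; rewrite ltn_pmod //; lia.
Qed.

Hypothesis k2 : 2%N \in [pchar k].

(** The Batalin-Vilkovisky operator f |-> h commutes with the differential.  The
    inner faces of f are handled by [sum_rotate_fuse]; its two outer faces give
    the same cyclic sum A, once shifted by one place, and cancel. *)
Lemma cyclic_trace_sdiff p f h X : slocal p.+1 f -> slocal p h ->
  (forall X, tau (h X * X p) = cyclic_trace p.+1 f X) ->
  tau (sdiff p h X * X p.+1) = cyclic_trace p.+2 (sdiff p.+1 f) X.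
Proof.
move=> lf lh hE.
have -> : cyclic_trace p.+2 (sdiff p.+1 f) X =
    \sum_(0 <= i < p.+2) \sum_(0 <= j < p.+1) tau (f (fuse j (rotate p.+2 i X))).
  pose A i := tau (f (rotate p.+2 i X) * X ((i + p.+1) %% p.+2)%N).
  transitivity (\sum_(0 <= i < p.+2) A ((1 + i) %% p.+2)%N
     + \sum_(0 <= i < p.+2) \sum_(0 <= j < p.+1) tau (f (fuse j (rotate p.+2 i X)))
     + \sum_(0 <= i < p.+2) A i).
    rewrite -!big_split; apply: eq_big_nat => i ip /=.
    rewrite /sdiff !traceD trace_sum; congr (_ + _ + _).
    rewrite tauC; congr (tau (_ * _)).
      apply: lf => l lp; rewrite /shift /rotate modnDml; congr (X (_ %% _)%N); lia.
    rewrite /rotate modnDml addn0 (_ : (1 + i + p.+1 = i + p.+2)%N) ?modnDr //; lia.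
  by rewrite (big_rotate _ p.+2 1 A) addrAC addrr_pchar2 // add0r.
rewrite (@sum_rotate_fuse _ _ _ _ (fun Y => tau (f Y))); last first.
  by move=> Y Z YZ; rewrite (lf Y Z).
rewrite /sdiff !mulrDl !traceD mulr_suml trace_sum -addrA; congr (_ + _).
  set Z := [eta _ with _ |-> _]; rewrite -/(cyclic_trace p.+1 f Z) -hE.
  rewrite /Z /= eqxx -mulrA tauC -mulrA; congr (tau (_ * _)).
  by apply: lh => l lp /=; case: eqP => //; lia.
rewrite big_nat_recr //=; congr (_ + _).
  apply: eq_big_nat => j jp; rewrite -/(cyclic_trace p.+1 f _) -hE /fuse.
  by congr (tau (_ * _)); prune_ifs.
rewrite -/(cyclic_trace p.+1 f _) -hE /fuse ltnn eqxx mulrA.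
by congr (tau (_ * _ * _)); apply: lh => l lp; case: ifP => //; lia.
Qed.

End CyclicTrace.

(** * Cochains as functions of sequences *)

Section Streams.

Definition pad T (x0 : T) p (x : 'I_p -> T) : nat -> T :=
  fun l => if insub l is Some i then x i else x0.

Lemma padE T (x0 : T) p (x : 'I_p -> T) (i : 'I_p) : pad x0 x i = x i.
Proof. by rewrite /pad valK. Qed.

Variables (k : fieldType) (B : algType k) (gB : grading B).

Definition stream_of p (c : ('I_p -> B) -> B) : (nat -> B) -> B :=
  fun X => c (fun i => X i).

Definition of_stream p (f : (nat -> B) -> B) : ('I_p -> B) -> B :=
  fun x => f (pad 0 x).

Lemma stream_of_local p (c : ('I_p -> B) -> B) : slocal p (stream_of c).
Proof. by move=> X Y XY; congr c; apply/funext => i; apply: XY. Qed.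

Lemma stream_of_pad p (c : ('I_p -> B) -> B) x : stream_of c (pad 0 x) = c x.
Proof. by congr c; apply/funext => i; rewrite padE. Qed.

Lemma of_streamK p f : slocal p f -> stream_of (@of_stream p f) = f.
Proof.
move=> lf; apply/funext => X; apply: lf => l lp.
by rewrite -[l]/(val (Ordinal lp)) padE.
Qed.

Lemma stream_of_inj p : injective (@stream_of p).
Proof. by move=> c c' cc; apply/funext => x; rewrite -!stream_of_pad cc. Qed.

Lemma stream_of_hdiff p (c : ('I_p -> B) -> B) :
  stream_of (hdiff idfun c) = sdiff p (stream_of c).
Proof.
apply/funext => X; rewrite /stream_of /hdiff /sdiff big_mkord.
congr (_ * _ + _ + _ * _).
- apply: eq_bigr => i _; congr c; apply/funext => l.
  rewrite /inner_face /fuse -val_eqE /= /bump.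
  by have ip := ltn_ord i; case: ltngtP => li; [congr X|congr X|congr (X _ * X _)]; lia.
- by congr c; apply/funext => l; rewrite /= /bump leqNgt ltn_ord.
Qed.

Lemma cochainsE p q (c : ('I_p -> B) -> B) :
  cochains gB gB q c <-> scochain gB p q (stream_of c).
Proof.
have updE (x : 'I_p -> B) (i : 'I_p) v :
    c [eta x with i |-> v] = stream_of c [eta pad 0 x with val i |-> v].
  by congr c; apply/funext => l /=; rewrite padE.
split=> [[mc hc]|[lc mc hc]]; split.
- exact: stream_of_local.
- move=> i X r y z ip.
  have E v : stream_of c [eta X with i |-> v] =
     c [eta (fun j : 'I_p => X j) with Ordinal ip |-> v] by [].
  by rewrite !E mc.
- by move=> n X Xn; rewrite big_mkord; apply: hc => i; apply: Xn.
- by move=> i x r y z; rewrite !updE mc ?ltn_ord.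
- move=> n x xn; have := hc (pad 0 n) (pad 0 x).
  rewrite stream_of_pad big_mkord; under eq_bigr do rewrite padE.
  by apply=> l lp; rewrite -[l]/(val (Ordinal lp)) !padE.
Qed.

Lemma stream_of_gsquare p (c : ('I_p.+1 -> B) -> B) :
  stream_of (gsquare c) = scomp p.+1 p (stream_of c) (stream_of c).
Proof.
apply/funext => X; rewrite /stream_of /gsquare /scomp big_mkord.
apply: eq_bigr => i _; congr c; apply/funext => l /=; rewrite /put /= -val_eqE /=.
have ip := ltn_ord i; have lp := ltn_ord l.
case: ltngtP => li; try by rewrite inordK //; lia.
by congr c; apply/funext => m; have mp := ltn_ord m; rewrite inordK // /shift; lia.
Qed.

End Streams.

(** * Hochschild classes *)

Section HochschildClasses.
Variables (k : fieldType) (A B : algType k) (j : A -> B).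
Variables (gA : grading A) (gB : grading B).
Local Notation cochain p := (('I_p -> A) -> B).
Local Notation HHj p q := (HH j gA gB p q).

Lemma eq_pi_HH p q (z z' : cocycle j gA gB p q) :
  \pi_(HHj p q) z = \pi_(HHj p q) z' <->
  coboundaries j gA gB q (cocycle_val z - cocycle_val z').
Proof.
have := Quotient.idealrBE (@is_coboundary _ _ _ j gA gB p q) z z'.
move=> zz'; split=> [/eqP|zB].
  by rewrite -zz' => /asboolP.
by apply/eqP; rewrite -zz'; apply/asboolP.
Qed.

Lemma cocycle_valP p q (z : cocycle j gA gB p q) :
  cochains gA gB q (cocycle_val z) /\ hdiff j (cocycle_val z) = 0.
Proof. by case: z => c /= /asboolP. Qed.

Lemma hclassE p q (c : cochain p) (cC : cochains gA gB q c) (dc : hdiff j c = 0) :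
  exists2 z : cocycle j gA gB p q, cocycle_val z = c & hclass j gA gB q c = \pi z.
Proof.
have cP : c \in @is_cocycle _ _ _ j gA gB p q by apply/asboolP.
exists (insubd (0 : cocycle j gA gB p q) c) => //.
by have := insubdK (0 : cocycle j gA gB p q) cP.
Qed.

Lemma hclass0 p q : hclass j gA gB q (0 : cochain p) = 0.
Proof.
rewrite /hclass -[X in insubd _ X]/(cocycle_val (0 : cocycle j gA gB p q)).
by rewrite valKd; exact: (raddf0 (\pi_(HHj p q))).
Qed.

(** This also holds when c is not known to be a cocycle, since the class is then
    0 by convention. *)
Lemma hclass_eq0 p q (c : cochain p) :
  coboundaries j gA gB q c -> hclass j gA gB q c = 0.
Proof.
move=> cB; have pi0 : \pi_(HHj p q) (0 : cocycle j gA gB p q) = 0.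
  exact: (raddf0 (\pi_(HHj p q))).
rewrite /hclass.
case: (pselect (c \in @is_cocycle _ _ _ j gA gB p q)) => cP; last first.
  by rewrite /insubd insubN; [exact: pi0|exact/negP].
rewrite -pi0; apply/eq_pi_HH; rewrite insubdK //.
by rewrite (_ : c - _ = c) //; apply: subr0.
Qed.

Lemma hclass_eq p q (c c' : cochain p) :
  cochains gA gB q c -> hdiff j c = 0 -> cochains gA gB q c' -> hdiff j c' = 0 ->
  coboundaries j gA gB q (c - c') -> hclass j gA gB q c = hclass j gA gB q c'.
Proof.
move=> cC dc cC' dc'; have [z <- ->] := hclassE cC dc.
by have [z' <- ->] := hclassE cC' dc' => /eq_pi_HH.
Qed.

Lemma hclass_inj p q (c c' : cochain p) :
  cochains gA gB q c -> hdiff j c = 0 -> cochains gA gB q c' -> hdiff j c' = 0 ->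
  hclass j gA gB q c = hclass j gA gB q c' -> coboundaries j gA gB q (c - c').
Proof.
move=> cC dc cC' dc'; have [z <- ->] := hclassE cC dc.
by have [z' <- ->] := hclassE cC' dc' => /eq_pi_HH.
Qed.

Lemma pi_hclass_coboundary p q (c : cochain p) (z : cocycle j gA gB p q) :
  cochains gA gB q c -> hdiff j c = 0 -> \pi_(HHj p q) z = hclass j gA gB q c ->
  coboundaries j gA gB q (cocycle_val z - c).
Proof. by move=> cC dc; have [z' <- ->] := hclassE cC dc => /eq_pi_HH. Qed.

End HochschildClasses.

(** * The derivation with respect to eps *)

Section GradedAlgebra.
Variables (k : fieldType) (d : nat).
Hypothesis k2 : 2%N \in [pchar k].

Lemma pchar2_bLam : 2%N \in [pchar bLam k].
Proof. by rewrite pchar_lalg. Qed.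

Lemma bLam_pieceM m n (x y : bLam k) :
  bLam_grading k d m x -> bLam_grading k d n y -> bLam_grading k d (m + n) (x * y).
Proof.
move=> xm yn l; rewrite lmulE => xyl.
have [i [xi yi]] : exists i, x i != 0 /\ y (l - i) != 0.
  apply: contrapT => /forallNP N; case/negP: xyl; rewrite big1 // => i _.
  have [->|xi] := eqVneq (x i) 0; first by rewrite mul0r.
  have [->|yi] := eqVneq (y (l - i)) 0; first by rewrite mulr0.
  by case: (N i).
by rewrite (xm _ xi) (yn _ yi) -opprD -mulrDr addrC subrK.
Qed.

Definition deriv_eps (x : bLam k) : bLam k := ubLam (fun=> x).

Lemma deriv_epsE x n : deriv_eps x n = ((x n : Lam k) : {poly k})`_1 *: 1.
Proof.
rewrite /deriv_eps /ubLam fsfun_fun; case: ifP => // /negbT.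
by rewrite memNfinsupp => /eqP ->; rewrite coef0 scale0r.
Qed.

Lemma deriv_eps_linear c x y : deriv_eps (c *: x + y) = c *: deriv_eps x + deriv_eps y.
Proof.
apply: laurentP => n; rewrite laddE lscaleE !deriv_epsE laddE lscaleE.
by rewrite coefD coefZ scalerDl scalerA.
Qed.

Lemma Lam_scale (c : k) (i : nat) (x : Lam k) :
  ((c *: x : Lam k) : {poly k})`_i = c * (x : {poly k})`_i.
Proof. exact: coefZ. Qed.

Lemma Lam_add (i : nat) (x y : Lam k) :
  ((x + y : Lam k) : {poly k})`_i = (x : {poly k})`_i + (y : {poly k})`_i.
Proof. exact: coefD. Qed.

Lemma Lam_sum (i : nat) I (r : seq I) (F : I -> Lam k) :
  ((\sum_(j <- r) F j : Lam k) : {poly k})`_i = \sum_(j <- r) (F j : {poly k})`_i.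
Proof.
by apply: (big_morph (fun x : Lam k => (x : {poly k})`_i));
  [exact: Lam_add|exact: coef0].
Qed.

(** The relation eps ^ 2 = 0 is respected because the derivative of eps ^ 2 is
    2 eps = 0. *)
Lemma Lam_derivation (x y : Lam k) :
  ((x * y : Lam k) : {poly k})`_1 *: (1 : Lam k) =
  ((x : {poly k})`_1 *: (1 : Lam k)) * y + x * ((y : {poly k})`_1 *: 1).
Proof.
rewrite -scalerAl -scalerAr mul1r mulr1; have [_ xy1] := Lam_mul x y.
apply: LamP; rewrite Lam_add !Lam_scale coefC /=.
  by rewrite mulr1 xy1; ring.
by rewrite mulr0 [X in _ + X]mulrC addrr_pchar2.
Qed.

Lemma deriv_epsM x y : deriv_eps (x * y) = deriv_eps x * y + x * deriv_eps y.
Proof.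
apply: laurentP => n; rewrite deriv_epsE laddE.
rewrite (@lmul_widen _ (deriv_eps x) y n (finsupp x)); last first.
  apply/fsubsetP => i; rewrite !mem_finsupp; apply: contra_neq => xi.
  by rewrite deriv_epsE xi coef0 scale0r.
rewrite !lmulE -big_split /= Lam_sum scaler_suml.
by apply: eq_bigr => i _; rewrite !deriv_epsE Lam_derivation.
Qed.

Lemma deriv_eps_piece n x : bLam_grading k d n x -> bLam_grading k d n (deriv_eps x).
Proof.
move=> xn l; rewrite deriv_epsE => xl; apply: xn; apply: contra_neq xl => ->.
by rewrite coef0 scale0r.
Qed.

End GradedAlgebra.

(** * The cocycles z . u ^ n *)

Section ClassU.
Variables (k : fieldType) (d : nat).
Hypothesis k2 : 2%N \in [pchar k].
Local Notation gB := (bLam_grading k d).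
Implicit Types (X : nat -> bLam k) (z : bLam k).
Let B2 := pchar2_bLam k2.
Let gM := @bLam_pieceM k d.

Definition uprod n X : bLam k := \prod_(0 <= i < n) deriv_eps (X i).

Lemma uprodS n : uprod n.+1 = scup 1 (fun X => deriv_eps (X 0%N)) (uprod n).
Proof. by apply/funext => X; rewrite /uprod /scup big_nat_recl. Qed.

Lemma deriv_epsK x : deriv_eps (deriv_eps x) = 0 :> bLam k.
Proof.
apply: laurentP => n; rewrite fsfun0E !deriv_epsE Lam_scale coefC /= mulr0.
by rewrite scale0r.
Qed.

Lemma deriv_eps_lmono1 n : deriv_eps (lmono n 1) = 0 :> bLam k.
Proof.
apply: laurentP => m; rewrite fsfun0E deriv_epsE lmonoE.
by case: ifP => _; rewrite ?coef0 ?coefC /= scale0r.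
Qed.

Lemma deriv_eps_uprod n X : deriv_eps (uprod n X) = 0.
Proof.
elim: n X => [|n IH] X; first by rewrite /uprod big_geq // deriv_eps_lmono1.
by rewrite uprodS /scup deriv_epsM // deriv_epsK IH mul0r mulr0 addr0.
Qed.

Lemma uprod_cochain n : scochain gB n 0 (uprod n).
Proof.
elim: n => [|n IH].
  split; first by move=> X Y _; rewrite /uprod !big_geq.
    by move=> i X c y z; rewrite ltn0.
  move=> N X _; rewrite /uprod !big_geq // addr0 => l.
  by rewrite lmonoE; case: ifP => [/eqP-> _|]; rewrite ?mulr0 ?oppr0 ?eqxx.
rewrite uprodS -[0]addr0 -[n.+1]add1n; apply: scochain_scup => //; split.
- by move=> X Y XY; rewrite XY.
- by move=> [|//] X c y z _; rewrite /= deriv_eps_linear.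
- by move=> N X XN; rewrite big_nat1 addr0; apply: deriv_eps_piece; apply: XN.
Qed.

(** As a derivation u is a cocycle, and the differential obeys the Leibniz rule for
    the cup product. *)
Lemma sdiff_uprod n : sdiff n (uprod n) = 0.
Proof.
apply/funext => X; elim: n X => [|n IH] X.
  by rewrite /sdiff big_geq // /uprod !big_geq // mulr1 mul1r addr0 addrr_pchar2.
rewrite uprodS -[n.+1]add1n sdiff_scup //; last by move=> Y Z YZ; rewrite YZ.
rewrite /scup IH mulr0 addr0 /sdiff big_nat1 /shift /fuse /= deriv_epsM //.
by rewrite [deriv_eps _ * _ + _]addrC addrA addrr_pchar2 // add0r addrr_pchar2 ?mul0r.
Qed.

Definition ucochain z n X := z * uprod n X.

Lemma ucochain_scochain z n r : gB r z -> scochain gB n r (ucochain z n).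
Proof.
move=> zr; rewrite -[r]addr0 -[n in scochain _ n]add0n.
apply: (@scochain_scup _ _ gB gM 0 n r 0 (fun=> z)) (uprod_cochain n); split => //.
by move=> N X _; rewrite big_geq // add0r.
Qed.

Lemma sdiff_ucochain z n : sdiff n (ucochain z n) = 0.
Proof.
apply/funext => X; rewrite -[n in sdiff n]add0n.
rewrite (@sdiff_scup _ _ B2 _ _ (fun=> z)) // /scup sdiff_uprod mulr0 addr0.
by rewrite /sdiff big_geq // addr0 [X 0%N * z]mulrC addrr_pchar2 ?mul0r.
Qed.

(** Each term applies u to a value of the cochain itself, which is z times values
    of u. *)
Lemma scomp_ucochain z n : deriv_eps z = 0 ->
  scomp n.+1 n (ucochain z n.+1) (ucochain z n.+1) = 0.
Proof.
move=> z0; apply/funext => X; apply: big1_seq => i /=; rewrite mem_index_iota => ip.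
rewrite {1}/ucochain /uprod (bigD1_seq i) ?mem_index_iota ?iota_uniq //=.
by rewrite /put /= eqxx deriv_epsM // z0 deriv_eps_uprod mul0r mulr0 addr0 mul0r mulr0.
Qed.

Lemma stream_of_class_u z n :
  stream_of (cup (const z) (cup_exp (@ubLam k) n)) = ucochain z n.
Proof.
apply/funext => X; rewrite /stream_of /cup /const; congr (_ * _).
transitivity (stream_of (cup_exp (@ubLam k) n) X).
  by congr (cup_exp _ _ _); apply/funext => i /=.
elim: n X => [|n IH] X; first by rewrite /uprod big_geq.
rewrite uprodS /scup -IH; congr (_ * _).
Qed.

Lemma ucochain_eps z n : ucochain z n (fun=> incl (eps k)) = z.
Proof.
rewrite /ucochain /uprod big1 ?mulr1 // => i _; apply: laurentP => m.
rewrite deriv_epsE !lmonoE; case: ifP => _; rewrite ?coef0 ?scale0r //.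
by rewrite eps1 scale1r.
Qed.

Lemma inclM (x y : Lam k) : incl (x * y) = incl x * incl y.
Proof.
apply: laurentP => m; rewrite (@lmul_widen _ _ _ _ [fset 0]%fset); last first.
  exact: finsupp_sub.
by rewrite big_seq_fset1 subr0 !lmonoE eqxx; case: ifP; rewrite ?mulr0.
Qed.

Lemma eps_sqr : eps k * eps k = 0.
Proof.
have [e0 e1] := Lam_mul (eps k) (eps k).
by apply: LamP; rewrite ?e0 ?e1 eps0 ?eps1 !coef0 ?mulr0 ?mul0r ?addr0.
Qed.

Lemma incl0 : incl 0 = 0 :> bLam k.
Proof. by apply: laurentP => m; rewrite lmonoE fsfun0E; case: ifP. Qed.

(** The inner faces contain eps ^ 2 = 0, and the two outer faces are equal.  So
    evaluation at (eps, .., eps) is well defined on classes. *)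
Lemma sdiff_eps p f : slocal p f -> smultilinear p f ->
  sdiff p f (fun=> incl (eps k)) = 0.
Proof.
move=> lf mf; rewrite /sdiff big_nat big1 ?addr0 => [|i /= ip].
  rewrite (_ : shift _ _ = fun=> incl (eps k)) // mulrC; exact: addrr_pchar2.
rewrite -(smultilinear0 (fun=> incl (eps k)) mf ip).
apply: lf => l lp; rewrite /fuse /=; case: ltngtP => // _.
by rewrite -inclM eps_sqr incl0.
Qed.

End ClassU.

(** * The Batalin-Vilkovisky operator on classes *)

Section BatalinVilkovisky.
Variables (k : fieldType) (d : nat) (a b : k).
Hypotheses (d_gt0 : (0 < d)%N) (b_neq0 : b != 0).
Local Notation gB := (bLam_grading k d).
Implicit Types (X : nat -> bLam k) (z : bLam k).

Definition trace (x : bLam k) : k := phi a b x 1.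

Lemma phi_trace x y : phi a b x y = trace (x * y).
Proof. by rewrite /trace !phi_coef mulr1. Qed.

Lemma trace_lin c x y : trace (c *: x + y) = c * trace x + trace y.
Proof. exact: phi_linearl. Qed.

Lemma traceC x y : trace (x * y) = trace (y * x).
Proof. by rewrite mulrC. Qed.

Lemma trace_piece m x : m != 0 -> gB m x -> trace x = 0.
Proof.
have [_ gphi _ _ _] := phi_graded_bimodule_iso a d_gt0 b_neq0.
move=> m0 xm; apply: (gphi m 0) => //; first by rewrite addr0.
by move=> l; rewrite lmonoE; case: ifP => [/eqP-> _|]; rewrite ?mulr0 ?oppr0 ?eqxx.
Qed.

Lemma BV_sumE p (c : ('I_p.+1 -> bLam k) -> bLam k) (x : 'I_p -> bLam k) y :
  (let X l := if unlift ord_max l is Some l' then x l' else y in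
   \sum_(i < p.+1) phi a b (c (fun l => X (i + l))) 1) =
  cyclic_trace trace p.+1 (stream_of c) [eta pad 0 x with p |-> y].
Proof.
rewrite /cyclic_trace big_mkord; apply: eq_bigr => i _.
congr trace; congr c; apply/funext => l; rewrite /rotate /=.
case: unliftP => [l'|] /= /(congr1 val) /= -> /=.
  rewrite /bump leqNgt ltn_ord add0n padE.
  by have /ltn_eqF-> := ltn_ord l'.
by rewrite eqxx.
Qed.

Lemma BV_cochainE p (c : ('I_p.+1 -> bLam k) -> bLam k) x w :
  (forall y, phi a b w y =
     cyclic_trace trace p.+1 (stream_of c) [eta pad 0 x with p |-> y]) ->
  BV_cochain (phi a b) c x = w.
Proof.
move=> wE; apply: xget_unique => [y|v vE].
  exact: etrans (wE y) (esym (BV_sumE _ _ _)).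
apply: (phi_inj b_neq0); apply/funext => y.
exact: etrans (vE y) (etrans (BV_sumE _ _ _) (esym (wE y))).
Qed.

Lemma lmono_piece n (x : Lam k) : gB (- (d%:Z * n)) (lmono n x).
Proof. by move=> m; rewrite lmonoE; case: ifP => [/eqP->|]; rewrite ?eqxx. Qed.

Lemma graded_dual0 : graded_dual gB (fun=> 0).
Proof. by split=> [c x y|]; [rewrite mulr0 addr0|exists [::]]. Qed.

Lemma graded_dualD f g :
  graded_dual gB f -> graded_dual gB g -> graded_dual gB (fun y => f y + g y).
Proof.
move=> [lf [s fs]] [lg [t gt]]; split=> [c x y|].
  by rewrite lf lg mulrDr addrACA.
exists (s ++ t) => n x; rewrite mem_cat negb_or => /andP[ns nt] xn.
by rewrite (fs n) ?(gt n) ?addr0.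
Qed.

(** This is what makes the Batalin-Vilkovisky cochain exist.  For homogeneous entries
    the functional lives in a single degree; arbitrary entries are finite sums of
    monomials and are decomposed one place at a time. *)
Lemma cyclic_trace_graded_dual p q f X : scochain gB p.+1 q f ->
  graded_dual gB (fun y => cyclic_trace trace p.+1 f [eta X with p |-> y]).
Proof.
move=> [lf mf hf].
have lin := cyclic_trace_multilinear trace_lin _ _ _ _ lf mf.
(* The entries from m on are already homogeneous. *)
suff H m N Y : (m <= p)%N -> (forall l, (m <= l < p)%N -> gB (N l) (Y l)) ->
    graded_dual gB (fun y => cyclic_trace trace p.+1 f [eta Y with p |-> y]).
  by apply: (H p (fun=> 0)) => // l; case: leqP.
elim: m N Y => [|m IH] N Y mp YN.
  split=> [c y z|]; first exact: lin.
  exists [:: - (\sum_(0 <= l < p) N l + q)] => n y; rewrite inE => nN yn.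
  apply: (@cyclic_trace_homogeneous _ _ gB _ _ q _ [eta N with p |-> n]) => //.
  - exact: trace_piece.
  - move=> l; rewrite ltnS leq_eqVlt /=; case: eqP => [->|_] //=; exact: YN.
  - rewrite big_nat_recr //= eqxx.
    rewrite (@eq_big_nat _ _ _ _ _ _ N) => [|l /= lp]; last by case: eqP => //; lia.
    by rewrite addrAC addrC addr_eq0.
pose Q v := graded_dual gB
  (fun y => cyclic_trace trace p.+1 f [eta [eta Y with m |-> v] with p |-> y]).
suff /(_ (Y m)) : forall v, Q v.
  rewrite /Q (_ : [eta Y with m |-> Y m] = Y :> (nat -> bLam k)) //.
  by apply/funext => l /=; case: eqP => [->|].
have swap v y : [eta [eta Y with m |-> v] with p |-> y] =
    [eta [eta Y with p |-> y] with m |-> v] :> (nat -> bLam k).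
  by apply/funext => l /=; do 2!case: eqP => //; lia.
have lin0 c u v y := lin m [eta Y with p |-> y] c u v (ltnW mp).
move=> v; rewrite (lmono_sum v); elim: (finsupp v : seq int) => [|n s IHs].
  rewrite big_nil /Q (_ : (fun y => _) = fun=> 0); first exact: graded_dual0.
  apply/funext => y; rewrite swap.
  have := lin0 1 0 0 y; rewrite scale1r addr0 mul1r.
  by set T := cyclic_trace _ _ _ _ => TT; rewrite -(subrr T) {2}TT addrK.
rewrite big_cons /Q; set u := lmono _ _; set w := \sum_(_ <- _) _.
rewrite (_ : (fun y => _) = fun y =>
    cyclic_trace trace p.+1 f [eta [eta Y with m |-> u] with p |-> y] +
    cyclic_trace trace p.+1 f [eta [eta Y with m |-> w] with p |-> y]); last first.
  apply/funext => y; rewrite !swap.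
  by have := lin0 1 u w y; rewrite scale1r mul1r.
apply: graded_dualD; last exact: IHs.
apply: (IH [eta N with m |-> - (d%:Z * n)]); first exact: ltnW.
move=> l lm /=; case: eqP => [_|lm']; first exact: lmono_piece.
by apply: YN; lia.
Qed.

Lemma BV_cochainP p q (c : ('I_p.+1 -> bLam k) -> bLam k) : cochains gB gB q c ->
  forall X, trace (stream_of (BV_cochain (phi a b) c) X * X p) =
    cyclic_trace trace p.+1 (stream_of c) X.
Proof.
move=> /cochainsE cC X.
have [w wE] := phi_surj a b_neq0 d_gt0
  (cyclic_trace_graded_dual (pad 0 (fun i : 'I_p => X i)) cC).
rewrite -phi_trace /stream_of (@BV_cochainE _ _ _ w) => [|y]; last by rewrite wE.
rewrite wE; apply: cyclic_trace_local; first by case: cC.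
move=> l; rewrite ltnS leq_eqVlt /=; case: eqP => [->|_] //= lp.
by rewrite -[l]/(val (Ordinal lp)) padE.
Qed.

Lemma trace_inj x y : (forall t, trace (x * t) = trace (y * t)) -> x = y.
Proof.
by move=> xy; apply: (@phi_inj _ a _ _ _ b_neq0); apply/funext => t; rewrite !phi_trace.
Qed.

Lemma BV_cochain_unique p q (c : ('I_p.+1 -> bLam k) -> bLam k) h :
  cochains gB gB q c -> slocal p h ->
  (forall X, trace (h X * X p) = cyclic_trace trace p.+1 (stream_of c) X) ->
  stream_of (BV_cochain (phi a b) c) = h.
Proof.
move=> cC lh hE; apply/funext => X; apply: trace_inj => t.
have E f : slocal p f -> f X = f [eta X with p |-> t].
  by move=> lf; apply: lf => l lp /=; case: eqP => //; lia.
rewrite (E _ lh) E; last exact: stream_of_local.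
have := BV_cochainP cC [eta X with p |-> t]; have := hE [eta X with p |-> t].
by rewrite /= eqxx => -> ->.
Qed.

(** Multilinearity and homogeneity are read off the defining equation, the trace
    form being nondegenerate. *)
Lemma BV_cochain_cochains p q (c : ('I_p.+1 -> bLam k) -> bLam k) :
  cochains gB gB q c -> cochains gB gB q (BV_cochain (phi a b) c).
Proof.
move=> cC; have cE := BV_cochainP cC; have [lc mc hc] := (cochainsE _ _ _).1 cC.
have lB := @stream_of_local _ _ _ (BV_cochain (phi a b) c).
set h := stream_of (BV_cochain (phi a b) c) in cE lB *.
have hE X t : trace (h X * t) =
    cyclic_trace trace p.+1 (stream_of c) [eta X with p |-> t].
  rewrite -cE /= eqxx; congr (trace (_ * _)).
  by apply: lB => l lp /=; case: eqP => //; lia.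
apply/cochainsE; split => //.
  move=> i X r y z ip; apply: trace_inj => t.
  have swap v : [eta [eta X with i |-> v] with p |-> t] =
      [eta [eta X with p |-> t] with i |-> v] :> (nat -> bLam k).
    by apply/funext => l /=; do 2!case: eqP => //; lia.
  rewrite mulrDl -scalerAl trace_lin !hE !swap.
  by apply: (cyclic_trace_multilinear trace_lin) => //; exact: ltnW.
move=> N X XN m; apply: contra_neq_eq => mN.
have E y : pairing a b (h X m) y = 0.
  rewrite -phi_lmono phi_trace hE.
  apply: (@cyclic_trace_homogeneous _ _ gB _ _ q _ [eta N with p |-> (d%:Z * m)]) => //.
  - exact: trace_piece.
  - move=> l; rewrite ltnS leq_eqVlt /=; case: eqP => [_|_] //=; last exact: XN.
    by have := @lmono_piece (- m) y; rewrite mulrN opprK.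
  - rewrite big_nat_recr //= eqxx.
    rewrite (@eq_big_nat _ _ _ _ _ _ N) => [|l /= lp]; last by case: eqP => //; lia.
    by rewrite addrAC addr_eq0.
have e0 : (h X m : {poly k})`_0 = 0.
  apply/eqP; have /eqP := E (eps k).
  by rewrite pairing_eps mulf_eq0 (negPf b_neq0) orbF.
apply: LamP; rewrite coef0 //; apply/eqP; have /eqP := E 1.
by rewrite pairing_1 e0 mul0r add0r mulf_eq0 (negPf b_neq0) orbF.
Qed.

Hypothesis k2 : 2%N \in [pchar k].

Lemma BV_cochain0 p : BV_cochain (phi a b) (0 : ('I_p.+1 -> bLam k) -> bLam k) = 0.
Proof.
apply/funext => x; apply: BV_cochainE => y.
rewrite phi_trace mul0r (trace0 trace_lin) /cyclic_trace big1 // => i _.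
exact: (trace0 trace_lin).
Qed.

Lemma BV_cochain_hdiff p q (c : ('I_p.+1 -> bLam k) -> bLam k) :
  cochains gB gB q c -> cochains gB gB q (hdiff idfun c) ->
  BV_cochain (phi a b) (hdiff idfun c) = hdiff idfun (BV_cochain (phi a b) c).
Proof.
move=> cC dC; apply: stream_of_inj; rewrite stream_of_hdiff.
have lB := @stream_of_local _ _ _ (BV_cochain (phi a b) c).
apply: (BV_cochain_unique dC) => [|X].
  by rewrite -stream_of_hdiff; exact: stream_of_local.
rewrite stream_of_hdiff; apply: (cyclic_trace_sdiff trace_lin traceC k2) => //.
  exact: stream_of_local.
exact: BV_cochainP cC.
Qed.

Lemma BV_cochainD p q (c c' : ('I_p.+1 -> bLam k) -> bLam k) :
  cochains gB gB q c -> cochains gB gB q c' -> cochains gB gB q (c + c') ->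
  BV_cochain (phi a b) (c + c') = BV_cochain (phi a b) c + BV_cochain (phi a b) c'.
Proof.
move=> cC cC' ccC; apply: stream_of_inj; apply: (BV_cochain_unique ccC).
  exact: stream_of_local.
move=> X; rewrite -[stream_of (_ + _) X]/(stream_of _ X + stream_of _ X).
rewrite mulrDl (traceD trace_lin) (BV_cochainP cC) (BV_cochainP cC') -big_split.
by apply: eq_bigr => i _; rewrite /= -(traceD trace_lin).
Qed.

(** Two representatives differ by some dg, and the operator maps dg to the boundary
    of the image of g.  The image of a cocycle is a cocycle for the same reason. *)
Lemma BV_hclass p q (c : ('I_p.+2 -> bLam k) -> bLam k) :
  cochains gB gB q c -> hdiff idfun c = 0 -> normalised c ->
  BV (phi a b) (hclass idfun gB gB q c) =
    hclass idfun gB gB q (BV_cochain (phi a b) c).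
Proof.
move=> cC dc nc; rewrite /BV.
have [z zc zE] := hclassE cC dc.
set P := (X in xget 0 X); have [nz' z'E] : P (xget 0 P).
  by apply: (@xgetPex _ 0 P); exists z; split; [rewrite zc|rewrite zE].
have [g gC gE] := pi_hclass_coboundary cC dc z'E.
have [z'C dz'] := cocycle_valP (xget 0 P).
move: (cocycle_val (xget 0 P)) gE z'C dz' => c' gE c'C dc'.
have c'E : c' = c + hdiff idfun g by rewrite gE addrC subrK.
have dgC : cochains gB gB q (hdiff idfun g).
  have [] := @is_cocycle_zmod_closed _ _ _ idfun gB gB p.+2 q => _ /(_ c' c).
  by rewrite gE; case/(_ _ _)/asboolP => //; apply/asboolP.
have ddg : hdiff idfun (hdiff idfun g) = 0 by rewrite gE hdiffB dc' dc subrr.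
have BC := BV_cochain_cochains.
have Bd0 (e : ('I_p.+2 -> bLam k) -> bLam k) : cochains gB gB q e ->
    hdiff idfun e = 0 -> hdiff idfun (BV_cochain (phi a b) e) = 0.
  move=> eC de; rewrite -(BV_cochain_hdiff eC) ?de ?BV_cochain0 //.
  by have [/asboolP[]] := @is_cocycle_zmod_closed _ _ _ idfun gB gB p.+3 q.
apply: hclass_eq; [exact: BC|exact: Bd0|exact: BC|exact: Bd0|].
exists (BV_cochain (phi a b) g); first exact: BC.
rewrite -(BV_cochain_hdiff gC dgC) c'E (BV_cochainD cC dgC) -?c'E //.
by rewrite addrAC subrr add0r.
Qed.

End BatalinVilkovisky.

(** * The Gerstenhaber square on classes *)

Section Square.
Variables (k : fieldType) (B : algType k) (gB : grading B).
Hypothesis B2 : 2%N \in [pchar B].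
Hypothesis gM : forall m n x y, gB m x -> gB n y -> gB (m + n) (x * y).
Implicit Types (f g : (nat -> B) -> B).

Lemma scomp0l p q g : scomp p q 0 g = 0.
Proof. by apply/funext => X; apply: big1. Qed.

Lemma scomp0r p q f : smultilinear p f -> scomp p q f 0 = 0.
Proof.
move=> mf; apply/funext => X; apply: big1_seq => i /=; rewrite mem_index_iota => ip.
exact: smultilinear0 mf ip.
Qed.

Lemma scompDl p q f f' g : scomp p q (f + f') g = scomp p q f g + scomp p q f' g.
Proof. by apply/funext => X; rewrite /scomp big_split. Qed.

Lemma scompDr p q f g g' : smultilinear p f ->
  scomp p q f (g + g') = scomp p q f g + scomp p q f g'.
Proof.
move=> mf; apply/funext => X.
rewrite -[RHS]/(scomp _ _ _ _ _ + scomp _ _ _ _ _) /scomp -big_split /=.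
by apply: eq_big_nat => i ip; rewrite -(smultilinearD _ _ _ mf ip).
Qed.

Lemma sdiffD p f g : sdiff p (f + g) = sdiff p f + sdiff p g.
Proof.
apply/funext => X; rewrite -[RHS]/(_ + _) /sdiff.
rewrite (eq_bigr (fun i => f (fuse i X) + g (fuse i X))) // big_split /=.
by rewrite mulrDr mulrDl !addrA (ACl (1*3*5*2*4*6))%AC.
Qed.

(** The difference is c o e + e o c + e o e with e = dg.  Gerstenhaber's formula for
    c o g, g o c and g o e produces these three terms and cup products; those of
    c and g cancel in pairs, and those of g and e are the boundary of g . g. *)
Lemma gsquare_coboundary p q (c : ('I_p.+2 -> B) -> B) (g : ('I_p.+1 -> B) -> B) :
  cochains gB gB q c -> hdiff idfun c = 0 ->
  cochains gB gB q g -> cochains gB gB q (hdiff idfun g) ->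
  hdiff idfun (hdiff idfun g) = 0 ->
  coboundaries idfun gB gB (q + q) (gsquare (c + hdiff idfun g) - gsquare c).
Proof.
move=> /cochainsE cC dc /cochainsE gC /cochainsE eC de.
set C := stream_of c in cC; set G := stream_of g in gC.
have EE : stream_of (hdiff idfun g) = sdiff p.+1 G by exact: stream_of_hdiff.
rewrite EE in eC.
have dC : sdiff p.+2 C = 0 by rewrite -stream_of_hdiff dc.
have dE : sdiff p.+2 (sdiff p.+1 G) = 0 by rewrite -EE -stream_of_hdiff de.
set E := sdiff p.+1 G in EE eC dE.
have [[lC mC _] [lG mG _]] := (cC, gC); have [lE mE _] := eC.
pose H := scomp p.+2 p C G + scomp p.+1 p.+1 G C +
  (scomp p.+1 p.+1 G E + scup p.+1 G G).
have HC : scochain gB (p.+1 + p.+1) (q + q) H.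
  apply: scochainD; apply: scochainD.
  - by rewrite -addSnnS; exact: scochain_scomp.
  - exact: scochain_scomp.
  - exact: scochain_scomp.
  - exact: scochain_scup.
exists (@of_stream _ _ (p.+1 + p.+1) H).
  by apply/cochainsE; rewrite of_streamK //; case: HC.
apply: stream_of_inj; rewrite stream_of_hdiff of_streamK; last by case: HC.
rewrite -[RHS]/(stream_of (gsquare (c + hdiff idfun g)) - stream_of (gsquare c)).
rewrite !stream_of_gsquare -[stream_of (c + _)]/(C + stream_of (hdiff idfun g)) EE -/C.
rewrite scompDl (scompDr _ C E mC) (scompDr _ C E mE) /H !sdiffD.
apply/funext => X.
rewrite -[LHS]/(sdiff _ _ X + sdiff _ _ X + (sdiff _ _ X + sdiff _ _ X)).
rewrite -{1}addSnnS !sdiff_scomp // ?sdiff_scup // dC dE -/E scomp0l (scomp0r _ mG).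
rewrite -[RHS]/(scomp _ _ C C X + scomp _ _ C E X
  + (scomp _ _ E C X + scomp _ _ E E X) - scomp _ _ C C X).
rewrite -[(0 : (nat -> B) -> B) X]/(0 : B) !addr0 !add0r.
set CC := scomp _ _ C C X; set CE := scomp _ _ C E X; set EC := scomp _ _ E C X.
rewrite [RHS]addrC !addrA addNr add0r.
rewrite (ACl ((1*4*7)*(2*6)*(3*5)*(8*11)*(9*10)))%AC /=.
by rewrite !addrr_pchar2 // !addr0.
Qed.

Lemma Sq_hclass_eq0 p q (c : ('I_p.+2 -> B) -> B) :
  cochains gB gB q c -> hdiff idfun c = 0 -> gsquare c = 0 ->
  Sq (hclass idfun gB gB q c) = 0.
Proof.
move=> cC dc c0; rewrite /Sq; set z := repr _.
have zE : \pi_(HH idfun gB gB p.+2 q) z = hclass idfun gB gB q c by rewrite reprK.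
have [g gC gE] := pi_hclass_coboundary cC dc zE.
have [zC dz] := cocycle_valP z.
have dgC : cochains gB gB q (hdiff idfun g).
  have [_ /(_ (cocycle_val z) c)] := @is_cocycle_zmod_closed _ _ _ idfun gB gB p.+2 q.
  by rewrite gE; case/(_ _ _)/asboolP => //; apply/asboolP.
have ddg : hdiff idfun (hdiff idfun g) = 0 by rewrite gE hdiffB dz dc subrr.
apply: hclass_eq0; have := gsquare_coboundary cC dc gC dgC ddg.
by rewrite c0 subr0 gE (addrC c) subrK.
Qed.

End Square.

(** * Restriction along a morphism *)

Section Restriction.
Variables (k : fieldType) (A B : algType k) (j : A -> B).
Variables (gA : grading A) (gB : grading B).
Hypothesis j_lin : forall c x y, j (c *: x + y) = c *: j x + j y.
Hypothesis jM : {morph j : x y / x * y}.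
Hypothesis j_gr : forall n x, gA n x -> gB n (j x).
Local Notation res c := (fun a => c (j \o a)).

Lemma res_hdiff p (c : ('I_p -> B) -> B) : hdiff j (res c) = res (hdiff idfun c).
Proof.
apply/funext => x; rewrite /hdiff; congr (_ + _ + _).
by apply: eq_bigr => i _; congr c; apply/funext => l;
  rewrite /inner_face /=; case: ifP => // _; rewrite jM.
Qed.

Lemma res_cochains p q (c : ('I_p -> B) -> B) :
  cochains gB gB q c -> cochains gA gB q (res c).
Proof.
move=> [mc hc]; split.
  move=> i x r y z; have E v : j \o [eta x with i |-> v] = [eta j \o x with i |-> j v].
    by apply/funext => l /=; case: ifP.
  by rewrite !E j_lin mc.
by move=> n x xn; apply: hc => i; apply: j_gr.
Qed.

Lemma restriction_hclass p q (c : ('I_p -> B) -> B) :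
  cochains gB gB q c -> hdiff idfun c = 0 ->
  restriction j gA (hclass idfun gB gB q c) = hclass j gA gB q (res c).
Proof.
move=> cC dc; rewrite /restriction; set z := repr _.
have zE : \pi_(HH idfun gB gB p q) z = hclass idfun gB gB q c by rewrite reprK.
have [zC dz] := cocycle_valP z.
have res0 (e : ('I_p -> B) -> B) : hdiff idfun e = 0 -> hdiff j (res e) = 0.
  by move=> de; rewrite res_hdiff de.
apply: hclass_eq; rewrite ?res0 //; try exact: res_cochains.
move: (pi_hclass_coboundary cC dc zE); move: (cocycle_val z) => {z zE zC dz} c'.
case: p c c' cC dc res0 => [|p] c c' cC dc res0 /=.
  by move=> cc'; apply/funext => x; exact: (congr1 (fun f => f (j \o x)) cc').
case=> g gC gE; exists (res g); first exact: res_cochains.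
by rewrite res_hdiff gE.
Qed.

End Restriction.

(** * The class of imath . u ^ n *)

Section Values.
Variables (k : fieldType) (d : nat) (a b : k).
Hypotheses (d_gt0 : (0 < d)%N) (b_neq0 : b != 0) (k2 : 2%N \in [pchar k]).
Local Notation gB := (bLam_grading k d).
Implicit Types (X : nat -> bLam k) (z : bLam k).
Let B2 := pchar2_bLam k2.

Definition class_u_cochain z n : ('I_n -> bLam k) -> bLam k :=
  cup (const z) (cup_exp (@ubLam k) n).

Arguments class_u_cochain z n x : clear implicits.

Lemma class_u_cochains z n : gB (- d%:Z) z ->
  cochains gB gB (- d%:Z) (class_u_cochain z n).
Proof.
move=> zd; apply/cochainsE; rewrite [stream_of _]stream_of_class_u.
exact: ucochain_scochain.
Qed.

Lemma hdiff_class_u z n : hdiff idfun (class_u_cochain z n) = 0.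
Proof.
apply: stream_of_inj; rewrite stream_of_hdiff [stream_of _]stream_of_class_u.
exact: sdiff_ucochain.
Qed.

(** Evaluate at (eps, .., eps), where coboundaries vanish. *)
Lemma class_u_eq0 z n : gB (- d%:Z) z -> class_u d z n = 0 -> z = 0.
Proof.
move=> zd z0; have zC := class_u_cochains n zd.
pose zero : ('I_n -> bLam k) -> bLam k := 0.
have [C0 d0] : cochains gB gB (- d%:Z) zero /\ hdiff idfun zero = 0.
  by have [/asboolP] := @is_cocycle_zmod_closed _ _ _ idfun gB gB n (- d%:Z).
have := hclass_inj zC (hdiff_class_u z n) C0 d0.
rewrite (hclass0 idfun gB gB n) => /(_ z0); rewrite subr0.
suff H : coboundaries idfun gB gB (- d%:Z) (class_u_cochain z n) ->
    class_u_cochain z n (fun=> incl (eps k)) = 0.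
  have E := congr1 (fun f => f (fun=> incl (eps k))) (stream_of_class_u z n).
  by move=> /H <-; rewrite -[LHS](ucochain_eps z n) -E.
move: (class_u_cochain z n) => c; case: n c {z0 zC C0 d0 zero} => [|n] c /=.
  by move=> ->.
case=> g /cochainsE[lg mg _] <-.
by have := sdiff_eps k2 lg mg; rewrite -stream_of_hdiff.
Qed.

(** The derivation is linear over its kernel, so f can be absorbed in y and one may
    take f = 1.  Then w is determined by phi w 1 = 0 and phi w eps = a, the sign
    of its coordinate at eps being immaterial in characteristic 2. *)
Lemma trace_adjoint f y : deriv_eps f = 0 ->
  trace a b (f * deriv_eps y) =
  trace a b (incl ((a / b)%:A + (a ^+ 2 / b ^+ 2) *: eps k) * f * y).
Proof.
move=> f0; have -> : f * deriv_eps y = deriv_eps (f * y).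
  by rewrite deriv_epsM // f0 mul0r add0r.
rewrite -mulrA; move: (f * y) => h; rewrite /trace !phi_coef !mulr1 deriv_epsE.
rewrite (@lmul_widen _ _ _ _ [fset 0]%fset); last exact: finsupp_sub.
rewrite big_seq_fset1 subr0 lmonoE eqxx !pairing_1.
have [-> ->] := Lam_mul ((a / b)%:A + (a ^+ 2 / b ^+ 2) *: eps k) (h 0).
rewrite !Lam_add !Lam_scale eps0 eps1 !coefC /=.
set h0 := (_)`_0; set h1 := (_)`_1.
have -> : ((a / b * 1 + a ^+ 2 / b ^+ 2 * 0) * h0) * a +
  ((a / b * 1 + a ^+ 2 / b ^+ 2 * 0) * h1 +
  (a / b * 0 + a ^+ 2 / b ^+ 2 * 1) * h0) * b =
  h1 * a + (a ^+ 2 / b * h0 + a ^+ 2 / b * h0) by field.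
by rewrite addrr_pchar2 // addr0 mulr1 mulr0 mul0r addr0.
Qed.

(** The cochain is symmetric, so the p + 1 rotations contribute equal terms and only
    the parity of their number matters. *)
Lemma BV_class_u z p : gB (- d%:Z) z -> deriv_eps z = 0 ->
  BV_cochain (phi a b) (class_u_cochain z p.+1) =
  if odd p.+1 then
    class_u_cochain (incl ((a / b)%:A + (a ^+ 2 / b ^+ 2) *: eps k) * z) p
  else 0.
Proof.
move=> zd z0; apply: stream_of_inj.
set w := incl _.
have -> : stream_of (if odd p.+1 then class_u_cochain (w * z) p else 0) =
    fun X => ucochain (w * z) p X *+ odd p.+1.
  by case: odd; rewrite ?[stream_of _]stream_of_class_u.
apply: (BV_cochain_unique d_gt0 b_neq0 (class_u_cochains p.+1 zd)) => [X Y XY|X].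
  congr (_ * _ *+ _); apply: eq_big_nat => i /= ip.
  by congr deriv_eps; apply: XY.
rewrite [stream_of _]stream_of_class_u.
transitivity (\sum_(0 <= i < p.+1) trace a b (ucochain z p.+1 X)).
  rewrite sumr_const_nat subn0 -{3}[p.+1]odd_double_half mulrnDr.
  rewrite -mul2n mulrnA mulr2n addrr_pchar2 // mul0rn addr0.
  case: odd; last by rewrite mul0r (trace0 (trace_lin a b)).
  rewrite !mulr1n /ucochain /uprod big_nat_recr //= mulrA trace_adjoint ?mulrA //.
  by rewrite deriv_epsM // z0 deriv_eps_uprod // mul0r mulr0 addr0.
apply: eq_big_nat => i ip; congr (trace a b (z * _)).
by rewrite /uprod -[LHS](big_rotate _ p.+1 i).
Qed.

Lemma incl_linear c x y : incl (c *: x + y) = c *: incl x + incl y :> bLam k.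
Proof.
apply: laurentP => n; rewrite laddE lscaleE !lmonoE.
by case: ifP; rewrite ?scaler0 ?addr0.
Qed.

Lemma incl_piece n x : Lam_grading k n x -> gB n (incl x).
Proof.
move=> xn m; rewrite lmonoE; case: ifP => [/eqP-> /xn ->|]; last by rewrite eqxx.
by rewrite mulr0 oppr0.
Qed.

Lemma ubLam_incl (x : 'I_1 -> Lam k) : ubLam (@incl k \o x) = incl (uLam x).
Proof.
apply: laurentP => m; rewrite [LHS]deriv_epsE !lmonoE.
by case: ifP => _; rewrite ?coef0 ?scale0r.
Qed.

Lemma cup_exp_incl n (x : 'I_n -> Lam k) :
  cup_exp (@ubLam k) n (@incl k \o x) = incl (cup_exp (@uLam k) n x).
Proof.
elim: n x => [|n IH] x //=.
by rewrite /cup inclM -ubLam_incl -IH.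
Qed.

Lemma imath_piece : gB (- d%:Z) (imath k).
Proof. by have := @lmono_piece k d 1 1; rewrite mulr1. Qed.

Lemma restriction_class_u n :
  restriction (@incl k) (Lam_grading k) (class_u d (imath k) n) =
  imath_cup d (cup_exp (@uLam k) n).
Proof.
rewrite /class_u -/(class_u_cochain _ _) restriction_hclass ?hdiff_class_u //.
- congr hclass; apply/funext => x.
  rewrite /class_u_cochain /cup /const /= -cup_exp_incl.
  by congr (_ * cup_exp _ _ _); apply/funext => i.
- exact: incl_linear.
- exact: inclM.
- exact: incl_piece.
- exact: class_u_cochains imath_piece.
Qed.

Lemma Sq_class_u n : Sq (class_u d (imath k) n.+2) = 0.
Proof.
apply: Sq_hclass_eq0 => //.
- exact: bLam_pieceM.
- exact: class_u_cochains imath_piece.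
- exact: hdiff_class_u.
apply: stream_of_inj; rewrite stream_of_gsquare.
rewrite (stream_of_class_u _ n.+2) scomp_ucochain //; exact: deriv_eps_lmono1.
Qed.

End Values.

Theorem proposition8p13 (k : fieldType) (d : nat) (a b : k) :
  (1 <= d)%N -> 2%N \in [pchar k] -> b != 0 ->
  let Delta p := @BV k (bLam k) (bLam_grading k d) (phi a b) p (- d%:Z) in
  let eta := cup_exp (@uLam k) d.+2 in
  let iota_eta := class_u d (imath k) d.+2 in
  (forall m : HHbLam k d d.+2 (- d%:Z),
      associated_class eta m ->
      m = iota_eta /\ Delta d.+1 m = Delta d.+1 iota_eta) /\
  (Delta d.+1 iota_eta =
     if odd d then
       class_u d (incl ((a / b)%:A + (a ^+ 2 / b ^+ 2) *: eps k) * imath k) d.+1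
     else 0) /\
  (Delta d.+1 iota_eta = 0 <-> ~~ odd d \/ (odd d /\ a = 0)).
Proof.
move=> d_gt0 k2 b_neq0 Delta eta iota_eta.
set w := _ + _ *: eps k.
have imd := @imath_piece k d.
have DeltaE : Delta d.+1 iota_eta =
    if odd d then class_u d (incl w * imath k) d.+1 else 0.
  rewrite /Delta /iota_eta /class_u -/(class_u_cochain _ _).
  rewrite BV_hclass //.
  - rewrite (BV_class_u a d_gt0 b_neq0 k2 d.+1 imd (deriv_eps_lmono1 k 1)) /= negbK.
    by case: odd => //; rewrite hclass0.
  - exact: class_u_cochains.
  - exact: hdiff_class_u.
  - move=> x i xi; rewrite -stream_of_pad stream_of_class_u /ucochain /uprod.
    rewrite (bigD1_seq (i : nat)) ?mem_index_iota ?iota_uniq //=.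
    by rewrite padE xi deriv_eps_lmono1 mul0r mulr0.
split; last split=> //.
  move=> m [_ mU]; suff -> : m = iota_eta by [].
  by apply: mU; split; [exact: Sq_class_u|exact: restriction_class_u].
rewrite DeltaE; case: odd; last by split; [left|].
split=> [w0|[//|[_ a0]]].
  right; split=> //; have wd : bLam_grading k d (- d%:Z) (incl w * imath k).
    rewrite -[- _]add0r; apply: bLam_pieceM => //.
    by have := @lmono_piece k d 0 w; rewrite mulr0 oppr0.
  have := congr1 (fun f : bLam k => f 1) (class_u_eq0 k2 wd w0).
  rewrite (@lmul_widen _ _ _ _ [fset 0]%fset); last exact: finsupp_sub.
  rewrite big_seq_fset1 subr0 !lmonoE eqxx mulr1 fsfun0E.
  move=> /(congr1 (fun x : Lam k => (x : {poly k})`_0)).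
  rewrite Lam_add !Lam_scale eps0 coefC coef0 /= mulr0 mulr1 addr0 => /eqP.
  by rewrite mulf_eq0 invr_eq0 (negPf b_neq0) orbF => /eqP.
have -> : incl w * imath k = 0.
  rewrite /w a0 mul0r expr0n /= mul0r !scale0r addr0.
  by rewrite (incl0 k) mul0r.
rewrite /class_u -(hclass0 _ _ _ _); congr hclass.
by apply/funext => x; rewrite /cup /const mul0r.
Qed.
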